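(* Let $s,t,p\ge 1$, $A,B\in GL(n)$, $Q\in\mathcal{P}(n)$, and put $c_1=\max\{\lambda_1^{1/t}(AQ^{-1}A^* ),\;\lambda_1^{1/p}(BQ^{-1}B^* )\}$. Suppose there exists $k>0$ such that $k^{-t}+k^{-p}<1$ and $$\lambda_1(c_1^sQ^{-1})\le(1-k^{-t}-k^{-p})k^{-s}.$$ Then $kc_1I\le Q^{1/s}$ and the equation $X^s+A^*X^{-t}A+B^*X^{-p}B=Q$ has a Hermitian positive definite solution in $[kc_1I,Q^{1/s}]$. Furthermore, if $$\frac1s(kc_1)^{1-s}\Big[\frac{t}{(kc_1)^{t+1}}\|A\|^2+\frac{p}{(kc_1)^{p+1}}\|B\|^2\Big]<1,$$ then this solution is the unique solution in $[kc_1I,Q^{1/s}]$.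
   Context: $GL(n)$: $n\times n$ complex nonsingular matrices; $\mathcal{P}(n)$: $n\times n$ Hermitian positive definite matrices. For Hermitian $M$, $\lambda_1(M)$ is its largest eigenvalue. $\|\cdot\|$ is the spectral norm. For Hermitian $P,R$, $P\le R$ means $R-P$ is positive semidefinite, and $[P,R]=\{X \text{ Hermitian}: P\le X\le R\}$. Real powers of positive definite matrices are defined by functional calculus. *)

(* Defs.v *)
From Stdlib Require Import Reals List ClassicalEpsilon.
Open Scope R_scope.

Record C := mkC { Re : R ; Im : R }.
Definition C0 : C := mkC 0 0.
Definition C1 : C := mkC 1 0.
Definition RtoC (r : R) : C := mkC r 0.
Definition Cadd (x y : C) : C := mkC (Re x + Re y) (Im x + Im y).
Definition Copp (x : C) : C := mkC (- Re x) (- Im x).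
Definition Cmul (x y : C) : C :=
  mkC (Re x * Re y - Im x * Im y) (Re x * Im y + Im x * Re y).
Definition Cconj (x : C) : C := mkC (Re x) (- Im x).
Definition Csum (n : nat) (f : nat -> C) : C :=
  fold_right Cadd C0 (map f (seq 0 n)).

(** Vectors and matrices (only indices < n are meaningful) *)
Definition Vec := nat -> C.
Definition Mat := nat -> nat -> C.

Definition meq (n : nat) (A B : Mat) : Prop :=
  forall i j, (i < n)%nat -> (j < n)%nat -> A i j = B i j.
Definition vnonzero (n : nat) (v : Vec) : Prop :=
  exists i, (i < n)%nat /\ v i <> C0.

Definition madd (A B : Mat) : Mat := fun i j => Cadd (A i j) (B i j).
Definition msub (A B : Mat) : Mat := fun i j => Cadd (A i j) (Copp (B i j)).
Definition mscale (r : R) (A : Mat) : Mat := fun i j => Cmul (RtoC r) (A i j).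
Definition mmul (n : nat) (A B : Mat) : Mat :=
  fun i j => Csum n (fun k => Cmul (A i k) (B k j)).
Definition madj (A : Mat) : Mat := fun i j => Cconj (A j i).
Definition mid : Mat := fun i j => if Nat.eqb i j then C1 else C0.
Definition mdiag (d : nat -> R) : Mat :=
  fun i j => if Nat.eqb i j then RtoC (d i) else C0.
Definition mvec (n : nat) (A : Mat) (v : Vec) : Vec :=
  fun i => Csum n (fun k => Cmul (A i k) (v k)).
Definition inner (n : nat) (u v : Vec) : C :=
  Csum n (fun k => Cmul (Cconj (u k)) (v k)).
Definition vnorm (n : nat) (v : Vec) : R := sqrt (Re (inner n v v)).

Definition invertible (n : nat) (A : Mat) : Prop :=
  exists B, meq n (mmul n A B) mid /\ meq n (mmul n B A) mid.
Definition minv (n : nat) (A : Mat) : Mat :=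
  epsilon (inhabits mid)
    (fun B => meq n (mmul n A B) mid /\ meq n (mmul n B A) mid).

Definition hermitian (n : nat) (A : Mat) : Prop := meq n (madj A) A.
Definition psd (n : nat) (A : Mat) : Prop :=
  hermitian n A /\ forall v : Vec, 0 <= Re (inner n v (mvec n A v)).
Definition pd (n : nat) (A : Mat) : Prop :=
  hermitian n A /\
  forall v : Vec, vnonzero n v -> 0 < Re (inner n v (mvec n A v)).
Definition mle (n : nat) (P Q : Mat) : Prop :=
  hermitian n P /\ hermitian n Q /\ psd n (msub Q P).
Definition in_interval (n : nat) (P Q X : Mat) : Prop :=
  hermitian n X /\ mle n P X /\ mle n X Q.

Definition unitary (n : nat) (U : Mat) : Prop := meq n (mmul n (madj U) U) mid.

Definition is_rpow (n : nat) (Q : Mat) (r : R) (Y : Mat) : Prop :=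
  exists (U : Mat) (d : nat -> R),
    unitary n U /\ (forall i, (i < n)%nat -> 0 < d i) /\
    meq n Q (mmul n U (mmul n (mdiag d) (madj U))) /\
    meq n Y (mmul n U (mmul n (mdiag (fun i => Rpower (d i) r)) (madj U))).
Definition mpow (n : nat) (Q : Mat) (r : R) : Mat :=
  epsilon (inhabits mid) (fun Y => is_rpow n Q r Y).

Definition is_eigenvalue (n : nat) (M : Mat) (l : R) : Prop :=
  exists v : Vec, vnonzero n v /\
    forall i, (i < n)%nat -> mvec n M v i = Cmul (RtoC l) (v i).
Definition lambda1 (n : nat) (M : Mat) : R :=
  epsilon (inhabits 0)
    (fun l => is_eigenvalue n M l /\ forall m, is_eigenvalue n M m -> m <= l).

Definition specnorm (n : nat) (A : Mat) : R :=
  epsilon (inhabits 0)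
    (fun m => is_lub (fun r => exists v : Vec, vnorm n v = 1 /\
                                  r = vnorm n (mvec n A v)) m).

Definition is_solution (n : nat) (s t p : R) (A B Q X : Mat) : Prop :=
  meq n (madd (mpow n X s)
          (madd (mmul n (madj A) (mmul n (mpow n X (- t)) A))
                (mmul n (madj B) (mmul n (mpow n X (- p)) B)))) Q.

(* Main.v *)
(* Put c = k c_1. The maps [x |-> max(x, c)^(-t)] and [x |-> max(x, c^s)^(1/s)] are Lipschitz,
   and a Lipschitz function of Hermitian matrices is Lipschitz with the same constant for
   the Frobenius norm (write both matrices in eigenbases and compare entry by entry). So
   the truncation of X |-> (Q - A^* X^(-t) A - B^* X^(-p) B)^(1/s) is a bounded continuous
   map of a finite-dimensional space and has a fixed point X by Brouwer's theorem, which
   is derived from Scarf's lemma on dominant sets. The choice of c_1 gives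
   A^* A <= c_1^t Q and B^* B <= c_1^p Q, hence Q - A^* X^(-t) A - B^* X^(-p) B >=
   (1 - k^(-t) - k^(-p)) Q >= c^s I: the truncations are inactive and X solves the equation.
   X <= Q^(1/s) is the Loewner-Heinz inequality. Under the last condition the untruncated
   map is a Frobenius contraction on matrices above c I, which gives uniqueness. *)
From Stdlib Require Import Reals ClassicalEpsilon.
Require Import Defs.
From mathcomp Require Import all_boot all_order all_algebra.
From mathcomp Require Import ring lra.
Set Implicit Arguments.
Unset Strict Implicit.
Unset Printing Implicit Defensive.
Import Order.TTheory GRing.Theory Num.Theory.
Close Scope R_scope.
(** * Scarf's combinatorial lemma *)


(** In the spectral norm a Lipschitz function may lose its constant when applied to matrices, hence
    the Frobenius norm. The spectral norms of A and B still fit, because |A^* D A|_F <= |A|^2 |D|_F.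
    The uniqueness condition is a product of scalar slopes: (1/s) c^(1-s) is the slope of x^(1/s) at
    c^s, and r / c^(r+1) that of x^(-r) at c. Norms are kept squared, so almost no square roots
    occur. The order interval is mapped to itself, but truncation spares a retraction onto it:
    Brouwer is only required for bounded Lipschitz maps of a whole space. Clipping from below
    suffices, since Q - A^* X^(-t) A - B^* X^(-p) B <= Q bounds the root from above. Scarf's lemma
    needs no triangulation of the simplex, only the orders of the grid points by each barycentric
    coordinate; its proof is a parity count. Loewner-Heinz is obtained without integral formulas:
    the exponents that preserve a given inequality contain 0 and 1 and are closed under midpoints
    and limits. *)

Lemma card_collision (A B : finType) (f : A -> B) (a : {set A}) :
  #|a| = #|f @: a|.+1 -> #|[set x in a | f @: (a :\ x) == f @: a]| = 2.
Proof.
move=> cardE.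
have ninj : ~~ [forall x in a, forall y in a, (f x == f y) ==> (x == y)].
  apply/negP => /forall_inP h.
  have : #|f @: a| = #|a|.
    apply: card_in_imset => x y xa ya fxy.
    by move/forall_inP: (h x xa) => /(_ y ya) /implyP /(_ (introT eqP fxy)) /eqP.
  by rewrite cardE => /eqP; rewrite -{1}(addn0 #|f @: a|) -addn1 eqn_add2l.
move: ninj; rewrite negb_forall_in => /exists_inP[x xa].
rewrite negb_forall_in => /exists_inP[y ya]; rewrite negb_imply => /andP[/eqP fxy nxy].
have imx : f @: (a :\ x) = f @: a.
  apply/setP/subset_eqP; rewrite imsetS ?subsetDl //=.
  apply/subsetP => _ /imsetP[z za ->]; have [->|zx] := eqVneq z x.
    by rewrite fxy imset_f // !inE eq_sym nxy.
  by rewrite imset_f // !inE zx.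
have injx : {in a :\ x &, injective f}.
  apply/imset_injP; rewrite imx; move: (cardsD1 x a).
  by rewrite xa cardE add1n => -[->].
(* One point too many for injectivity means a single collision [f x = f y]; these two points, and no
   others, can be removed without shrinking the image. This 2 is the count behind the parity
   argument. *)
suff -> : [set z in a | f @: (a :\ z) == f @: a] = [set x; y] by rewrite cards2 nxy.
apply/setP => z; rewrite !inE; apply/andP/orP => [[za /eqP imz]|].
  have [->|zx] := eqVneq z x; first by left.
  right; move: (imset_f f za); rewrite -imz => /imsetP[w].
  rewrite !inE => /andP[wz wa] fzw; have [wx|wx] := eqVneq w x.
    apply/eqP/injx; [by rewrite !inE zx | by rewrite !inE eq_sym nxy |].
    by rewrite fzw wx.
  suff wzE : w = z by rewrite wzE eqxx in wz.
  by apply: injx; [rewrite !inE wx | rewrite !inE zx |].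
move=> zxy; have [->|zx] := eqVneq z x; first by rewrite imx.
have {z zxy zx} -> : z = y by case: zxy => /eqP // zE; rewrite zE eqxx in zx.
split=> //.
rewrite -imx eqEsubset; apply/andP; split; apply/subsetP => u /imsetP[w].
  rewrite !inE => /andP[wy wa] ->; have [->|wx] := eqVneq w x.
    by rewrite fxy imset_f // !inE eq_sym nxy.
  by rewrite imset_f // !inE wx.
rewrite !inE => /andP[wy wa] ->; have [->|wx] := eqVneq w y.
  by rewrite -fxy imset_f // !inE nxy.
by rewrite imset_f // !inE wx.
Qed.

Section Scarf.
Variables (T I : finType) (rk : I -> T -> nat).
Hypothesis rk_inj : forall i, injective (rk i).

Definition lowest i y (s : {set T}) := [forall x in s, rk i y <= rk i x].
(** [y] ranges over all of [T], not only over [s]: no point may exceed the minimum of [s] in every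
    order of [C] at once. *)
Definition dominant (s : {set T}) (C : {set I}) :=
  [forall y, exists i in C, lowest i y s].

Lemma lowestP i y (s : {set T}) :
  reflect (forall x, x \in s -> rk i y <= rk i x) (lowest i y s).
Proof. exact: forall_inP. Qed.

Lemma dominantP (s : {set T}) (C : {set I}) :
  reflect (forall y, exists2 i, i \in C & lowest i y s) (dominant s C).
Proof. by apply: (iffP forallP) => h y; apply/exists_inP/h. Qed.

Lemma dominantW (s s' : {set T}) (C C' : {set I}) :
  s' \subset s -> C \subset C' -> dominant s C -> dominant s' C'.
Proof.
move=> ss CC /dominantP h; apply/dominantP => y; have [i iC /lowestP l] := h y.
exists i; first exact: (subsetP CC).
by apply/lowestP => x xs; apply/l/(subsetP ss).
Qed.

Lemma lowest_uniq i x y (s : {set T}) :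
  x \in s -> y \in s -> lowest i x s -> lowest i y s -> x = y.
Proof.
move=> xs ys /lowestP lx /lowestP ly; apply: (@rk_inj i).
by apply/eqP; rewrite eqn_leq lx // ly.
Qed.

(** Dominance applied to the points of [s] themselves: each is the minimum of [s] in some order of
    [C]. Hence |s| <= |C|; taking minima is a bijection from [C] on a room and has exactly one
    collision on a door. *)
Lemma dominant_imset (s : {set T}) (C : {set I}) (z0 : T) :
  z0 \in s -> dominant s C ->
  exists2 f : I -> T, (forall k, f k \in s /\ lowest k (f k) s) & f @: C = s.
Proof.
move=> z0s /dominantP sC; pose f k := [arg min_(z < z0 in s) rk k z].
have fP k : f k \in s /\ lowest k (f k) s.
  by rewrite /f; case: arg_minnP => // z zs zmin; split=> //; apply/lowestP.
exists f => //; apply/setP/subset_eqP/andP; split; apply/subsetP => x.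
  by case/imsetP => k _ ->; case: (fP k).
move=> xs; have [k kC lk] := sC x; apply/imsetP; exists k => //.
by have [fs fl] := fP k; apply: (lowest_uniq xs fs lk fl).
Qed.

(* A dominant pair [(s, C)] is a room if [#|C| = #|s|] and a door if [#|C| = #|s| + 1];
   a door opens onto the rooms obtained by adding a point to [s] or removing an
   index from [C]. *)
Definition rooms_add (s : {set T}) (C : {set I}) :=
  [set x | (x \notin s) && dominant (x |: s) C].
Definition rooms_rem (s : {set T}) (C : {set I}) :=
  [set i in C | dominant s (C :\ i)].

Section Door.
Variables (s : {set T}) (C : {set I}) (z0 : T).
Hypotheses (z0s : z0 \in s) (sC : dominant s C) (cardC : #|C| = #|s|.+1).
Variable mn : I -> T.
Hypotheses (mnP : forall k, mn k \in s /\ lowest k (mn k) s) (mn_imset : mn @: C = s).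

(** The two indices of the door whose minima coincide; each will open exactly one room. *)
Let cand := [set i in C | mn @: (C :\ i) == mn @: C].

(** The obstructions to discarding [i]. If there are none, removing [i] gives a room; otherwise a
    point must be added, and the [i]-highest obstruction, [top i], is the only possible one. *)
Let undom i := [set y | [forall k in C :\ i, ~~ lowest k y s]].

Let undomP i y : reflect (forall k, k \in C -> k != i -> ~~ lowest k y s) (y \in undom i).
Proof.
rewrite inE; apply: (iffP forall_inP) => h k.
  by move=> kC ki; apply: h; rewrite !inE ki kC.
by rewrite !inE => /andP[ki kC]; apply: h.
Qed.

Let top i := [arg max_(y > odflt z0 [pick y in undom i] in undom i) rk i y].

Let undom_lowest i y : y \in undom i -> lowest i y s.
Proof.
move=> /undomP u; have [k kC lk] := dominantP _ _ sC y.
by have [<- //|ki] := eqVneq k i; move: (u k kC ki); rewrite lk.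
Qed.

Let undom0 i : undom i = set0 <-> dominant s (C :\ i).
Proof.
split=> [u0|/dominantP h].
  apply/dominantP => y; have := in_set0 y; rewrite -u0 inE => /negbT.
  rewrite negb_forall_in => /exists_inP[k kC]; rewrite negbK => lk; by exists k.
apply/setP => y; rewrite in_set0; apply/negP => /undomP u.
have [k] := h y; rewrite !inE => /andP[ki kC] lk.
by move: (u k kC ki); rewrite lk.
Qed.

Let topP i : undom i != set0 ->
  top i \in undom i /\ (forall y, y \in undom i -> rk i y <= rk i (top i)).
Proof.
case/set0Pn => y yu; rewrite /top; case: pickP => [y0 y0u|/(_ y)]; last by rewrite yu.
by case: arg_maxnP.
Qed.

(** An obstruction lies below all of [s] in order [i], hence also below the highest one. Any other
    point is lowest in some order [k] other than [i], where [top i] lies above a point of [s] and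
    does no harm. *)
Let top_room i : i \in cand -> undom i != set0 -> top i \in rooms_add s C.
Proof.
rewrite inE mn_imset => /andP[iC /eqP ims] /topP[/undomP tu tmax]; rewrite inE.
apply/andP; split.
  apply/negP; rewrite -ims => /imsetP[k]; rewrite !inE => /andP[ki kC] tk.
  by move: (tu k kC ki); rewrite tk; case: (mnP k) => _ ->.
apply/dominantP => y; have [yu|] := boolP (y \in undom i).
  exists i => //; apply/lowestP => x; rewrite !inE => /orP[/eqP->|]; first exact: tmax.
  by move: x; apply/lowestP/undom_lowest.
rewrite inE negb_forall_in => /exists_inP[k]; rewrite !inE negbK => /andP[ki kC] lk.
exists k => //; apply/lowestP => x; rewrite !inE => /orP[/eqP->|]; last first.
  by move: x; apply/lowestP.
move: (tu k kC ki); rewrite negb_forall_in => /exists_inP[z zs].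
by rewrite -ltnNge => /ltnW; apply: leq_trans; apply: (lowestP _ _ _ lk).
Qed.

(** Let [i] be the order in which [x] is the minimum of [x |: s]. The minima in the other orders are
    those of [s] and already cover [s], so [i] is one of the two colliding indices. *)
Let room_top x : x \in rooms_add s C ->
  exists2 i, (i \in cand) && (undom i != set0) & x = top i.
Proof.
rewrite inE => /andP[xs xd].
have cardE : #|x |: s| = #|C| by rewrite cardsU1 xs cardC.
have [f fP fC] := dominant_imset (setU11 x s) xd.
have finj : {in C &, injective f} by apply/imset_injP; rewrite fC cardE.
have : x \in f @: C by rewrite fC setU11.
case/imsetP => i iC xi.
have fs k : k \in C -> k != i -> f k \in s.
  move=> kC ki; have [] := fP k; rewrite !inE => /orP[/eqP fkx|//] _.
  by rewrite (finj k i kC iC _) ?eqxx // in ki; rewrite fkx.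
have fmn k : k \in C -> k != i -> mn k = f k.
  move=> kC ki; have [ms ml] := mnP k; have [_ /lowestP fl] := fP k.
  apply: (lowest_uniq ms (fs k kC ki) ml); apply/lowestP => z zs.
  by apply: fl; rewrite inE zs orbT.
have xu : x \in undom i.
  apply/undomP => k kC ki; apply/negP => /lowestP lx.
  have := lx _ (fs k kC ki); have [_ /lowestP/(_ x (setU11 x s))] := fP k.
  move=> h1 h2; have /rk_inj fx : rk k (f k) = rk k x by apply/eqP; rewrite eqn_leq h1 h2.
  by move: (fs k kC ki); rewrite fx (negbTE xs).
have un0 : undom i != set0 by apply/set0Pn; exists x.
exists i.
  rewrite un0 andbT inE iC /= mn_imset eqEsubset; apply/andP; split.
    by apply/subsetP => _ /imsetP[k _ ->]; case: (mnP k).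
  apply/subsetP => z zs; have : z \in f @: C by rewrite fC inE zs orbT.
  case/imsetP => k kC zk; have ki : k != i.
    by apply/eqP => ki; rewrite zk ki -xi (negbTE xs) in zs.
  by rewrite zk -(fmn k kC ki) imset_f // !inE ki.
have [tu tmax] := topP un0; apply: (@rk_inj i); apply/eqP; rewrite eqn_leq tmax //=.
have [k kC /lowestP lk] := dominantP _ _ xd (top i).
have [ki|ki] := eqVneq k i; first by rewrite ki in lk; apply/lk/setU11.
move/undomP/(_ k kC ki): tu => /negP[]; apply/lowestP => z zs.
by apply: lk; rewrite inE zs orbT.
Qed.

Lemma door_rooms_of_selection : #|rooms_add s C| + #|rooms_rem s C| = 2.
Proof.
have <- : #|cand| = 2 by apply: card_collision; rewrite mn_imset.
rewrite -(cardsID [set i | undom i != set0] cand); congr (_ + _).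
  suff -> : rooms_add s C = top @: (cand :&: [set i | undom i != set0]).
    apply: card_in_imset => i j; rewrite !inE.
    move=> /andP[/andP[iC _] ui] /andP[/andP[jC _] uj] tij.
    apply/eqP/negP => /negP nij; have [ti _] := topP ui; have [tj _] := topP uj.
    rewrite -tij in tj; have li := undom_lowest ti.
    by move/undomP: tj => /(_ i iC nij); rewrite li.
  apply/setP => x; apply/idP/imsetP => [/room_top[i]|[i]].
    by case/andP => ic iu ->; exists i => //; rewrite inE ic inE.
  by rewrite inE inE => /andP[ic iu] ->; apply: top_room.
apply: eq_card => i; rewrite inE [RHS]inE [in RHS]inE negbK.
apply/andP/andP => [[iC /[dup] d /undom0 u0]|[/eqP/undom0 d]].
  rewrite u0 eqxx; split=> //; rewrite inE iC /= mn_imset.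
  have [g gP <-] := dominant_imset z0s d.
  apply/eqP/eq_imset => k; have [ms ml] := mnP k; have [gs gl] := gP k.
  exact: (lowest_uniq ms gs ml gl).
by rewrite inE => /andP[iC _]; split.
Qed.

End Door.

Lemma card_door_rooms (s : {set T}) (C : {set I}) (z0 : T) :
  z0 \in s -> dominant s C -> #|C| = #|s|.+1 ->
  #|rooms_add s C| + #|rooms_rem s C| = 2.
Proof.
move=> z0s sC cC; have [f fP fC] := dominant_imset z0s sC.
exact: (door_rooms_of_selection z0s sC cC fP fC).
Qed.

(** The door without points has a single room, given by the maximum of order [i]; removing [i] would
    leave no order to dominate with. All other doors have two rooms, and this asymmetry drives the
    parity argument. *)
Lemma card_outer_door_rooms (x0 : T) (i : I) :
  #|rooms_add set0 [set i]| + #|rooms_rem set0 [set i]| = 1.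
Proof.
have -> : rooms_rem set0 [set i] = set0.
  apply/setP => j; rewrite !inE; apply/negP => /andP[/eqP-> /dominantP/(_ x0)[k]].
  by rewrite setDv inE.
have [z _ zmax] := @arg_maxnP T x0 predT (rk i) isT.
have {}zmax y : rk i y <= rk i z := zmax y isT.
suff -> : rooms_add set0 [set i] = [set z] by rewrite cards1 cards0.
apply/setP => x; rewrite !inE /= setU0; apply/dominantP/eqP => [h|->].
  have [j /set1P-> /lowestP/(_ x (set11 x)) zx] := h z.
  by apply: (@rk_inj i); apply/eqP; rewrite eqn_leq zx zmax.
move=> y; exists i; first by rewrite inE.
by apply/lowestP => w /set1P->; apply: zmax.
Qed.

Section Labelling.
Variables (x0 : T) (i0 : I) (l : T -> I).

Let room (r : {set T} * {set I}) := dominant r.1 r.2 && (#|r.1| == #|r.2|).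
(** Labels restrict the doors so that, in the graph of doors and rooms, odd degree is possible only
    at [(set0, [set i0])] and at a room with [l @: s = C]. *)
Let door (d : {set T} * {set I}) :=
  [&& dominant d.1 d.2, #|d.2| == #|d.1|.+1, i0 \in d.2 & l @: d.1 == d.2 :\ i0].
Let adj (r d : {set T} * {set I}) :=
  (r.2 == d.2) && [exists x, (x \notin d.1) && (r.1 == x |: d.1)]
  || (r.1 == d.1) && [exists i, (i \in d.2) && (r.2 == d.2 :\ i)].

Let card_rooms_of d : door d ->
  #|[set r | room r && adj r d]| = #|rooms_add d.1 d.2| + #|rooms_rem d.1 d.2|.
Proof.
case: d => s C; rewrite /door /= => /and4P[sC /eqP cC i0C _].
have -> : [set r | room r && adj r (s, C)] =
    [set (x |: s, C) | x in rooms_add s C] :|: [set (s, C :\ i) | i in rooms_rem s C].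
  apply/setP => -[s' C']; rewrite !inE /room /adj /=; apply/idP/orP.
    case/andP => /andP[d' c'] /orP[/andP[/eqP Ce /existsP[x /andP[xs /eqP se]]]|].
      by subst; left; apply/imsetP; exists x => //; rewrite inE xs.
    case/andP => /eqP se /existsP[i /andP[iC /eqP Ce]]; subst.
    by right; apply/imsetP; exists i => //; rewrite inE iC.
  case=> /imsetP[x]; rewrite inE => /andP[xs d'] [-> ->]; rewrite d'.
    rewrite cardsU1 xs cC eqxx eqxx /=; apply/orP; left; apply/existsP; exists x.
    by rewrite xs eqxx.
  rewrite eqxx /=; apply/andP; split.
    by move: cC; rewrite (cardsD1 x C) xs add1n => -[->].
  by apply/orP; right; apply/existsP; exists x; rewrite xs eqxx.
rewrite cardsU.
have -> : [set (x |: s, C) | x in rooms_add s C] :&: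
          [set (s, C :\ i) | i in rooms_rem s C] = set0.
  apply/setP => r; rewrite !inE; apply/negP => /andP[/imsetP[x]].
  rewrite inE => /andP[xs _] -> /imsetP[i _ [sE _]].
  by move: xs; rewrite -sE setU11.
rewrite cards0 subn0; congr (_ + _); apply: card_in_imset => u v; rewrite !inE.
  move=> /andP[us _] /andP[vs _] [E]; have : u \in v |: s by rewrite -E setU11.
  by rewrite !inE (negbTE us) orbF => /eqP.
move=> /andP[uC _] /andP[vC _] [E]; have : u \notin C :\ v by rewrite -E !inE eqxx.
by rewrite !inE uC andbT negbK => /eqP.
Qed.

Let odd_rooms_of d : door d ->
  odd #|[set r | room r && adj r d]| = (d == (set0, [set i0])).
Proof.
move=> dd; rewrite card_rooms_of //; case: d dd => s C.
rewrite /door /= => /and4P[sC /eqP cC i0C lsE].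
have [s0|[z zs]] := set_0Vmem s.
  have CE : C = [set i0].
    apply/eqP; rewrite eq_sym eqEcard sub1set i0C cC s0 cards0 cards1 //.
  by rewrite s0 CE card_outer_door_rooms // eqxx.
rewrite (card_door_rooms zs) //=; apply/esym/negbTE.
by apply/eqP => -[sE _]; rewrite sE inE in zs.
Qed.

Let even_doors_of r : room r -> l @: r.1 != r.2 ->
  ~~ odd #|[set d | door d && adj r d]|.
Proof.
case: r => s C; rewrite /room /= => /andP[sC /eqP cC] nfull.
have doorE d : door d && adj (s, C) d ->
    i0 \in C /\ ((exists2 x, x \in s & d = (s :\ x, C) /\ l @: (s :\ x) = C :\ i0)
    \/ (exists2 i, i \notin C & d = (s, i |: C) /\ l @: s = i |: (C :\ i0))).
  case: d => s' C'; rewrite /door /adj /= => /andP[/and4P[d' c' i0C' /eqP lE]].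
  case/orP => /andP[/eqP E /existsP[x /andP[xs /eqP E2]]]; subst.
    split=> //; left; exists x; first exact: setU11.
    by rewrite setU1K.
  have nx : x != i0 by apply/eqP => xi; rewrite lE xi eqxx in nfull.
  split; first by rewrite !inE eq_sym nx.
  right; exists x; first by rewrite !inE eqxx.
  rewrite setD1K //; split=> //; rewrite lE; apply/setP => y; rewrite !inE.
  by have [->|] := eqVneq y x; rewrite ?nx //= => _; rewrite andbC.
have [i0C|i0C] := boolP (i0 \in C); last first.
  suff -> : [set d | door d && adj (s, C) d] = set0 by rewrite cards0.
  apply/setP => d; rewrite inE in_set0; apply/negP => /doorE[].
  by rewrite (negbTE i0C).
have cE : #|s| = #|C :\ i0|.+1 by rewrite cC (cardsD1 i0 C) i0C.
have remdoor x : x \in s -> l @: (s :\ x) = C :\ i0 ->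
    door (s :\ x, C) && adj (s, C) (s :\ x, C).
  move=> xs lE; rewrite /door /adj /= lE eqxx i0C !andbT.
  rewrite (dominantW (subsetDl _ _) (subxx _) sC) /= -cC (cardsD1 x s) xs add1n !eqxx /=.
  apply/orP; left; apply/existsP; exists x.
  by rewrite setD1K // !inE !eqxx.
have remcount : l @: s = C :\ i0 -> #|[set d | door d && adj (s, C) d]| = 2.
  move=> lE; rewrite -(@card_collision _ _ l s) ?lE //.
  have injf : {in [set x in s | l @: (s :\ x) == C :\ i0] &,
                 injective (fun x => (s :\ x, C))}.
    move=> u v; rewrite !inE => /andP[us _] /andP[vs _] [E].
    have : u \notin s :\ v by rewrite -E !inE eqxx.
    by rewrite !inE us andbT negbK => /eqP.
  rewrite -(card_in_imset injf); apply: eq_card => d; rewrite inE.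
  apply/idP/imsetP => [/doorE[_ [[x xs [-> lx]]|[i iC [_ lE2]]]]|[x]].
  - by exists x => //; rewrite inE xs lx eqxx.
  - have : i \in C :\ i0 by rewrite -lE lE2 setU11.
    by rewrite !inE (negbTE iC) andbF.
  - by rewrite inE => /andP[xs /eqP lx] ->; apply: remdoor.
have addcount i : i \notin C -> l @: s = i |: (C :\ i0) ->
    #|[set d | door d && adj (s, C) d]| = 2.
  move=> iC lE; have iCi : i \notin C :\ i0 by rewrite !inE (negbTE iC) andbF.
  have linj : {in s &, injective l} by apply/imset_injP; rewrite lE cardsU1 iCi cE.
  have : i \in l @: s by rewrite lE setU11.
  case/imsetP => x xs ix.
  have lsx : l @: (s :\ x) = C :\ i0.
    apply/setP => j; apply/imsetP/idP => [[y]|jC].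
      rewrite !inE => /andP[yx ys] ->; have : l y \in i |: (C :\ i0) by rewrite -lE imset_f.
      rewrite !inE => /orP[/eqP lyi|//].
      by rewrite (linj y x) ?eqxx // in yx; rewrite lyi.
    have : j \in l @: s by rewrite lE inE jC orbT.
    case/imsetP => y ys jy; exists y => //; rewrite !inE ys andbT.
    by apply: contraNneq iCi => yx; rewrite ix -yx -jy.
  suff -> : [set d | door d && adj (s, C) d] = [set (s :\ x, C); (s, i |: C)].
    rewrite cards2; suff -> : (s :\ x, C) != (s, i |: C) by [].
    by apply/eqP => -[_ CE]; rewrite CE setU11 in iC.
  apply/setP => d; rewrite !inE; apply/idP/orP.
    case/doorE => _ [[y ys [-> ly]]|[j jC [-> lj]]].
      left; suff -> : y = x by [].
      apply: (linj y x ys xs); rewrite -ix.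
      have : i \in l @: s by rewrite lE setU11.
      case/imsetP => w ws iw; have [->//|wy] := eqVneq y w.
      by move: iCi; rewrite -ly iw imset_f // !inE eq_sym wy.
    right; suff -> : j = i by [].
    have : j \in i |: (C :\ i0) by rewrite -lE lj setU11.
    by rewrite !inE (negbTE jC) andbF orbF => /eqP.
  case=> /eqP ->; first exact: remdoor.
  have ii0 : i != i0 by apply: contraNneq iC => ->.
  rewrite /door /adj /= (dominantW (subxx _) (subsetUr _ _) sC) cardsU1 iC cC eqxx /=.
  rewrite !inE i0C orbT lE /= eqxx /=; apply/andP; split.
    apply/eqP/setP => y; rewrite !inE.
    by have [->|] := eqVneq y i; rewrite ?ii0.
  apply/orP; right; apply/existsP; exists i.
  by rewrite setU11 setU1K /=.
have [lE|lE] := eqVneq (l @: s) (C :\ i0); first by rewrite remcount.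
have [->|[d]] := set_0Vmem [set d | door d && adj (s, C) d]; first by rewrite cards0.
rewrite inE => /doorE[_ [[x xs [_ lx]]|[i iC [_ ls]]]]; last by rewrite (addcount i).
have lsE : l @: s = l x |: (C :\ i0) by rewrite -{1}(setD1K xs) imsetU1 lx.
rewrite (addcount (l x)) //; apply/negP => lxC.
have [lxi|lxi] := eqVneq (l x) i0; first by rewrite lsE lxi setD1K ?eqxx // in nfull.
by move: lE; rewrite lsE; case/eqP; apply/setUidPr; rewrite sub1set !inE lxi.
Qed.

Theorem scarf_lemma :
  exists s C, [/\ dominant s C, #|s| = #|C| & l @: s = C].
Proof.
have [/existsP[[s C] /andP[/andP[sC /eqP cC] /eqP lE]]|nex] :=
    boolP [exists r, room r && (l @: r.1 == r.2)]; first by exists s, C.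
have odd_sum (J : finType) (P : pred J) (F : J -> nat) :
    odd (\sum_(j | P j) F j) = \big[addb/false]_(j | P j) odd (F j).
  exact: (big_morph odd oddD).
have cardE (J : finType) (P : pred J) : #|[set j | P j]| = \sum_j P j.
  by rewrite -sum1_card big_mkcond; apply: eq_bigr => j _; rewrite inE; case: (P j).
(* Incident pairs are counted by doors and by rooms. Without a fully labelled room the right side is
   even, while on the left exactly the outer door contributes an odd number. *)
have key : \sum_(d | door d) #|[set r | room r && adj r d]| =
           \sum_(r | room r) #|[set d | door d && adj r d]|.
  transitivity (\sum_(d | door d) \sum_(r | room r) adj r d).
    apply: eq_bigr => d _; rewrite cardE [RHS]big_mkcond.
    by apply: eq_bigr => r _; case: (room r).
  rewrite exchange_big; apply: eq_bigr => r _; rewrite cardE [LHS]big_mkcond.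
  by apply: eq_bigr => d _; case: (door d).
move/(congr1 odd): key; rewrite !odd_sum [RHS]big1 => [|r rr]; last first.
  apply/negbTE/even_doors_of => //; apply: contra nex => lE.
  by apply/existsP; exists r; rewrite rr.
rewrite (eq_bigr (fun d => d == (set0, [set i0]))); last by move=> d; apply: odd_rooms_of.
have dd : door (set0, [set i0]).
  rewrite /door /= cards0 cards1 inE imset0 setDv !eqxx !andbT.
  apply/dominantP => y; exists i0; first by rewrite inE.
  by apply/lowestP => x; rewrite inE.
rewrite (bigD1 _ dd) /= eqxx big1 // => d /andP[_ /negbTE//].
Qed.

End Labelling.
End Scarf.

(** * Approximate fixed points *)


Section Grid.
Variables (m N : nat).

Definition grid := {g : {ffun 'I_m.+1 -> 'I_N.+1} | \sum_i g i == N :> nat}.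

Definition grid_coord (g : grid) (i : 'I_m.+1) : nat := sval g i.

Lemma grid_sum (g : grid) : \sum_i grid_coord g i = N.
Proof. by rewrite /grid_coord; case: g => g /= gN; apply/eqP. Qed.

Lemma grid_of_fun (f : 'I_m.+1 -> nat) : \sum_i f i = N ->
  exists g : grid, grid_coord g =1 f.
Proof.
move=> fN; have fle i : f i < N.+1 by rewrite ltnS -fN (bigD1 i) //= leq_addr.
have gP : \sum_i [ffun i => inord (f i) : 'I_N.+1] i == N :> nat.
  by apply/eqP; rewrite -[RHS]fN; apply: eq_bigr => i _; rewrite ffunE inordK.
exists (exist (fun g : {ffun 'I_m.+1 -> 'I_N.+1} => \sum_i g i == N :> nat) _ gP) => i.
by rewrite /grid_coord /= ffunE inordK.
Qed.

(* Ties between grid points with the same coordinate are broken by enumeration. *)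
Definition grid_rank (i : 'I_m.+1) (g : grid) : nat :=
  grid_coord g i * #|{: grid}| + enum_rank g.

Lemma grid_rank_inj i : injective (grid_rank i).
Proof.
move=> g h; rewrite /grid_rank => E; apply: enum_rank_inj; apply: val_inj => /=.
by move/(congr1 (modn^~ #|{: grid}|)): E; rewrite !modnMDl !modn_small.
Qed.

Lemma grid_rank_coord i g h :
  grid_rank i g <= grid_rank i h -> grid_coord g i <= grid_coord h i.
Proof.
rewrite /grid_rank => gh; rewrite leqNgt; apply/negP => hg; move: gh; rewrite leqNgt.
move/negP; apply; apply: (@leq_trans ((grid_coord h i).+1 * #|{: grid}|)).
  by rewrite mulSn addnC ltn_add2r.
by apply: leq_trans (leq_addr _ _); rewrite leq_mul2r hg orbT.
Qed.

(** The minimal coordinates of [s] over [C] almost exhaust [N]: their sum exceeds N - |C|. A point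
    of [s] lies above these minima and has sum [N], so what it has beyond them is less than m+1 in
    total; outside [C] this bounds the whole coordinate. *)
Lemma dominant_grid_close (s : {set grid}) (C : {set 'I_m.+1}) (z w : grid) i :
  dominant grid_rank s C -> z \in s -> w \in s ->
  grid_coord w i <= (if i \in C then grid_coord z i else 0) + m.+1.
Proof.
move=> sC zs ws; have [f fP _] := dominant_imset (@grid_rank_inj) zs sC.
pose a k := grid_coord (f k) k.
have ale k y : y \in s -> a k <= grid_coord y k.
  by move=> ys; have [_ /lowestP/(_ y ys)/grid_rank_coord] := fP k.
have big_a : N < \sum_(k in C) (a k).+1.
  rewrite ltnNge; apply/negP => aN.
  have [k1 k1C _] := dominantP _ _ _ sC z.
  (* A grid point strictly above every minimum: one more than [a k] on [C], with the leftover of [N]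
     put on [k1]. It contradicts dominance. *)
  pose b k := if k == k1 then N - \sum_(k in C | k != k1) (a k).+1
              else if k \in C then (a k).+1 else 0.
  have sb : \sum_k b k = N.
    rewrite (bigD1 k1) //= {1}/b eqxx.
    have -> : \sum_(k | k != k1) b k = \sum_(k in C | k != k1) (a k).+1.
      rewrite [RHS]big_mkcondl; apply: eq_bigr => k /negbTE kk.
      by rewrite /b kk.
    by rewrite subnK // (leq_trans _ aN) // [leqRHS](bigD1 k1) //= leq_addl.
  have [y yb] := grid_of_fun sb.
  have [k kC /lowestP/(_ (f k))] := dominantP _ _ _ sC y.
  have [fs _] := fP k => /(_ fs)/grid_rank_coord; rewrite yb -/(a k) /b.
  have [E|_] := eqVneq k k1; last by rewrite kC ltnn.
  rewrite E leq_subLR => NN; move: aN; rewrite (bigD1 k1) //= => /leq_trans/(_ NN).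
  by rewrite addSn addnC ltnn.
have lt : \sum_k grid_coord w k < \sum_k (if k \in C then a k else 0) + m.+1.
  rewrite grid_sum; apply: leq_trans big_a _.
  have -> : \sum_(k in C) (a k).+1 = \sum_(k in C) a k + #|C|.
    by rewrite -sum1_card -big_split; apply: eq_bigr => k _; rewrite /= addn1.
  rewrite -big_mkcond leq_add2l; apply: leq_trans (max_card _) _.
  by rewrite card_ord.
rewrite (bigD1 i) //= [X in _ < X + _](bigD1 i) //= in lt.
have le : \sum_(k < m.+1 | k != i) (if k \in C then a k else 0) <=
          \sum_(k < m.+1 | k != i) grid_coord w k.
  by apply: leq_sum => k _; case: ifP => // _; apply: ale.
have le2 : (if i \in C then a i else 0) <= (if i \in C then grid_coord z i else 0).
  by case: ifP => // _; apply: ale.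
rewrite (leq_trans _ (leq_add le2 (leqnn _))) //.
move: lt; rewrite addnAC; set u := grid_coord w i; set v := (if _ then _ else _).
move=> lt; rewrite -(leq_add2r (\sum_(k < m.+1 | k != i) grid_coord w k)).
apply: ltnW; apply: leq_trans lt _; by rewrite leq_add2l.
Qed.

End Grid.

Section ApproximateFixpoint.
Local Open Scope ring_scope.
Variables (R : realFieldType) (m : nat) (G : 'rV[R]_m -> 'rV[R]_m) (M K : R).
Hypotheses (M0 : 0 < M) (K0 : 0 <= K).
Hypothesis Gbound : forall x j, `|G x 0 j| <= M.
Hypothesis Glip : forall (x y : 'rV[R]_m) d, (forall j, `|x 0 j - y 0 j| <= d) ->
  forall j, `|G x 0 j - G y 0 j| <= K * d.

(** Side of a simplex with corner (-M, ..., -M) that contains the cube [-M, M]^m: each (x_j + M) / L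
    is at most 1/(m+1), so the last barycentric coordinate stays nonnegative. *)
Let L := 2 * M * m.+1%:R.

Section Mesh.
Variable N : nat.
Hypothesis N0 : (0 < N)%N.

Let pt (g : grid m N) : 'rV[R]_m :=
  \row_j (L * ((grid_coord g (lift ord_max j))%:R / N%:R) - M).

(* The barycentric coordinates, scaled by [N], of the image of a grid point. *)
Let img g (i : 'I_m.+1) : R :=
  if unlift ord_max i is Some j then (G (pt g) 0 j + M) / L * N%:R
  else N%:R - \sum_j (G (pt g) 0 j + M) / L * N%:R.

Let L0 : 0 < L. Proof. by rewrite !mulr_gt0 // ltr0n. Qed.
Let NR0 : 0 < N%:R :> R. Proof. by rewrite ltr0n. Qed.

Let img_sum g : \sum_i img g i = N%:R.
Proof.
rewrite big_ord_recr /= {2}/img unlift_none.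
rewrite [X in X + _](_ : _ = \sum_j (G (pt g) 0 j + M) / L * N%:R) ?subrKC //.
apply: eq_bigr => j _; rewrite /img.
have -> : widen_ord (leqnSn m) j = lift ord_max j.
  by apply: val_inj; rewrite /= /bump leqNgt ltn_ord.
by rewrite liftK.
Qed.

Let img_ge0 g i : 0 <= img g i.
Proof.
have Gb j : - M <= G (pt g) 0 j <= M by rewrite -ler_norml.
rewrite /img; case: unliftP => [j _|_].
  rewrite mulr_ge0 ?ler0n // divr_ge0 ?(ltW L0) //.
  by have /andP[] := Gb j; rewrite -subr_ge0 opprK.
rewrite subr_ge0; apply: le_trans (_ : \sum_(j < m) N%:R / m.+1%:R <= _).
  apply: ler_sum => j _; rewrite mulrC ler_pM2l // ler_pdivrMr // /L mulrCA.
  rewrite mulVf ?pnatr_eq0 // mulr1.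
  by have /andP[_] := Gb j => h; lra.
rewrite sumr_const card_ord -[_ *+ m]mulr_natr -mulrA ler_piMr ?ler0n //.
by rewrite mulrC ler_pdivrMr ?ltr0n // mul1r ler_nat.
Qed.

(** A coordinate that does not decrease from [g] to its image. It exists because both sum to [N], so
    the default [ord0] is never reached. *)
Let lab g := odflt ord0 [pick i | (grid_coord g i)%:R <= img g i].

Let labP g : (grid_coord g (lab g))%:R <= img g (lab g).
Proof.
rewrite /lab; case: pickP => //= none.
have : \sum_i img g i < \sum_i (grid_coord g i)%:R.
  apply: ltr_sum; first by apply/hasP; exists ord0; rewrite // mem_index_enum.
  by move=> i _; rewrite ltNge none.
by rewrite img_sum -natr_sum grid_sum ltxx.
Qed.

Let pt_bound g j : `|pt g 0 j| <= L + M.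
Proof.
have cN : (grid_coord g (lift ord_max j))%:R / N%:R <= 1 :> R.
  rewrite ler_pdivrMr // mul1r ler_nat -[leqRHS](grid_sum g).
  by rewrite (bigD1 (lift ord_max j)) //= leq_addr.
have c0 : 0 <= (grid_coord g (lift ord_max j))%:R / N%:R :> R.
  by rewrite divr_ge0 ?ler0n.
rewrite mxE; move: cN c0; set u := _ / _ => u1 u0.
have h : L * u <= L by rewrite ler_piMr // ltW.
have h' : 0 <= L * u by rewrite mulr_ge0 // ltW.
rewrite ler_norml lerBlDr opprD lerD2r (le_trans _ h') ?oppr_le0 ?(ltW L0) //=.
by rewrite (le_trans h) // -addrA lerDl addr_ge0 // ltW.
Qed.

(** The mesh L / N and the scaling N / L cancel, leaving K (m+1) for an ordinary coordinate; the
    last one adds up m of these, whence the square. *)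
Let img_lip g h : (forall i, `|(grid_coord g i)%:R - (grid_coord h i)%:R| <= m.+1%:R :> R) ->
  forall i, `|img g i - img h i| <= K * m.+1%:R ^+ 2.
Proof.
move=> gh.
have ptd j : `|pt g 0 j - pt h 0 j| <= L * (m.+1%:R / N%:R).
  rewrite !mxE opprB addrA subrK -mulrBr -mulrBl normrM (gtr0_norm L0) ler_pM2l //.
  by rewrite normrM normfV (gtr0_norm NR0) ler_pM2r ?invr_gt0.
have Gd j : `|(G (pt g) 0 j + M) / L * N%:R - (G (pt h) 0 j + M) / L * N%:R|
    <= K * m.+1%:R.
  rewrite -!mulrBl opprD addrACA subrr addr0 !normrM normfV (gtr0_norm L0).
  rewrite (gtr0_norm NR0); have := Glip ptd j.
  have -> : K * m.+1%:R = K * (L * (m.+1%:R / N%:R)) / L * N%:R.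
    by field; rewrite !gt_eqF.
  by rewrite ler_pM2r // ler_pM2r // invr_gt0.
move=> i; rewrite /img; case: unliftP => [j _|_].
  apply: le_trans (Gd j) _; rewrite ler_wpM2l // expr2 ler_peMr ?ler0n //.
  by rewrite ler1n.
rewrite opprB addrC addrA subrK -sumrB.
apply: le_trans (ler_norm_sum _ _ _) _.
apply: le_trans (_ : \sum_(j < m) K * m.+1%:R <= _).
  by apply: ler_sum => j _; rewrite distrC.
rewrite sumr_const card_ord -[_ *+ m]mulr_natr -mulrA ler_wpM2l // expr2.
by rewrite ler_wpM2l ?ler0n // ler_nat.
Qed.

Lemma mesh_point : exists x : 'rV[R]_m, (forall j, `|x 0 j| <= L + M) /\
  forall j, `|G x 0 j - x 0 j| <=
    L * (m.+1%:R * (K * m.+1%:R ^+ 2 + m.+1%:R)) / N%:R.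
Proof.
have [x0 _] : exists x : grid m N, grid_coord x =1 (fun i => if i == ord0 then N else 0%N).
  by apply: grid_of_fun; rewrite -big_mkcond big_pred1_eq.
have [s [C [sC cC lC]]] := @scarf_lemma _ _ _ (@grid_rank_inj m N) x0 ord0 lab.
have [i1 i1C _] := dominantP _ _ _ sC x0.
have [x xs] : exists x, x \in s.
  by move: i1C; rewrite -lC => /imsetP[x xs _]; exists x.
exists (pt x); split; first exact: pt_bound.
have close z : z \in s ->
    forall i, `|(grid_coord z i)%:R - (grid_coord x i)%:R| <= m.+1%:R :> R.
  move=> zs i; have h u v : u \in s -> v \in s ->
      (grid_coord u i)%:R - (grid_coord v i)%:R <= m.+1%:R :> R.
    move=> us vs; rewrite lerBlDr addrC -natrD ler_nat.
    apply: leq_trans (dominant_grid_close i sC vs us) _.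
    by rewrite leq_add2r; case: ifP.
  by rewrite ler_norml h // lerNl opprB h.
set D := K * m.+1%:R ^+ 2 + m.+1%:R.
have D0 : 0 <= D by rewrite addr_ge0 ?mulr_ge0 ?exprn_ge0 ?ler0n.
(* For [i] in [C] some [z] of the room has label [i], so its coordinate does not exceed that of its
   image, and [x] is close to [z]. For [i] outside [C] the coordinate itself is at most m+1. *)
have below i : (grid_coord x i)%:R - img x i <= D.
  have [iC|iC] := boolP (i \in C).
    move: (iC); rewrite -lC => /imsetP[z zs iz]; have zi := labP z; rewrite -iz in zi.
    have := img_lip (close z zs) i; have := close z zs i.
    rewrite !ler_norml => /andP[h1 h2] /andP[h3 h4].
    by rewrite /D; lra.
  have := dominant_grid_close i sC xs xs; rewrite (negbTE iC) add0n -(@ler_nat R) => h.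
  have := img_ge0 x i; have : 0 <= K * m.+1%:R ^+ 2 by rewrite mulr_ge0 ?exprn_ge0 ?ler0n.
  by rewrite /D; lra.
(* The differences sum to zero, so the missing bound for one coordinate is the sum of the one-sided
   bounds for the others. *)
have close_img i : `|img x i - (grid_coord x i)%:R| <= m.+1%:R * D.
  rewrite ler_norml; apply/andP; split.
    rewrite lerNl opprB; apply: le_trans (below i) _.
    by rewrite ler_peMl // ler1n.
  have : \sum_k (img x k - (grid_coord x k)%:R) = 0.
    by rewrite sumrB img_sum -natr_sum grid_sum subrr.
  rewrite (bigD1 i) //= => /eqP; rewrite addr_eq0 => /eqP ->; rewrite -sumrN.
  apply: le_trans (_ : \sum_(k < m.+1) D <= _); last first.
    by rewrite sumr_const card_ord mulr_natl.
  rewrite [leRHS](bigD1 i) //= -[leLHS]add0r lerD //.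
  by apply: ler_sum => k _; rewrite opprB.
move=> j; have := close_img (lift ord_max j); rewrite /img liftK => h.
have -> : G (pt x) 0 j - pt x 0 j =
   ((G (pt x) 0 j + M) / L * N%:R - (grid_coord x (lift ord_max j))%:R) * (L / N%:R).
  rewrite [pt x 0 j]mxE; field; by rewrite !gt_eqF.
rewrite normrM (gtr0_norm (divr_gt0 L0 NR0)) [leRHS]mulrAC mulrC ler_pM2l //.
exact: divr_gt0.
Qed.

End Mesh.

End ApproximateFixpoint.

From mathcomp Require Import spectral sesquilinear complex.
(** * Frobenius norm and functional calculus *)

Section ComplexMatrices.
Local Open Scope ring_scope.
Local Open Scope complex_scope.
Variable R : rcfType.
Implicit Types (z : R[i]).

Definition cn2 z : R := complex.Re z ^+ 2 + complex.Im z ^+ 2.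

Lemma cn2_ge0 z : 0 <= cn2 z.
Proof. by rewrite addr_ge0 ?sqr_ge0. Qed.

Lemma cn2_eq0 z : (cn2 z == 0) = (z == 0).
Proof. by rewrite paddr_eq0 ?sqr_ge0 // !sqrf_eq0 eq_complex. Qed.

Lemma conjc_mul z : conjc z * z = (cn2 z)%:C.
Proof.
by case: z => a b; apply/eqP; rewrite eq_complex /cn2 /=; apply/andP; split; apply/eqP; ring.
Qed.

Lemma cn2J z : cn2 (conjc z) = cn2 z.
Proof. by case: z => a b; rewrite /cn2 /= sqrrN. Qed.

Lemma cn2M_real (a : R) z : cn2 (a%:C * z) = a ^+ 2 * cn2 z.
Proof. by case: z => u v; rewrite /cn2 /=; ring. Qed.

Lemma conjcM_real (a : R) z : conjc (a%:C * z) = a%:C * conjc z.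
Proof.
by case: z => u v; apply/eqP; rewrite eq_complex /=; apply/andP; split; apply/eqP; ring.
Qed.

Lemma ReD (y z : R[i]) : complex.Re (y + z) = complex.Re y + complex.Re z.
Proof. by case: y; case: z. Qed.

Lemma ReM_real (a : R) z : complex.Re (a%:C * z) = a * complex.Re z.
Proof. by case: z => u v /=; ring. Qed.

Lemma Re_sum (I : Type) (r : seq I) (P : pred I) (F : I -> R[i]) :
  complex.Re (\sum_(i <- r | P i) F i) = \sum_(i <- r | P i) complex.Re (F i).
Proof. by apply: (big_morph _ ReD). Qed.

Definition adj m n (A : 'M[R[i]]_(m, n)) : 'M[R[i]]_(n, m) :=
  map_mx (@conjc R) A^T.

Lemma adjE m n (A : 'M[R[i]]_(m, n)) i j : adj A j i = conjc (A i j). Proof. by rewrite !mxE. Qed.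

Section Adjoint.
Variables m n p : nat.
Implicit Types (A B : 'M[R[i]]_(m, n)).

Lemma adjK A : adj (adj A) = A.
Proof. by apply/matrixP => i j; rewrite !adjE conjcK. Qed.

Lemma adjD A B : adj (A + B) = adj A + adj B.
Proof. by rewrite /adj linearD map_mxD. Qed.

Lemma adjB A B : adj (A - B) = adj A - adj B.
Proof. by rewrite /adj linearB map_mxB. Qed.

Lemma adjM A (B : 'M[R[i]]_(n, p)) : adj (A *m B) = adj B *m adj A.
Proof. by rewrite /adj trmx_mul map_mxM. Qed.

Lemma adjZ (a : R) A : adj (a%:C *: A) = a%:C *: adj A.
Proof. by apply/matrixP => i j; rewrite !mxE conjcM_real. Qed.

End Adjoint.

Definition fro2 m n (A : 'M[R[i]]_(m, n)) : R := \sum_i \sum_j cn2 (A i j).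

Lemma fro2_ge0 m n (A : 'M[R[i]]_(m, n)) : 0 <= fro2 A.
Proof. by do 2![apply: sumr_ge0 => ? _]; apply: cn2_ge0. Qed.

Lemma cn2_le_fro2 m n (A : 'M[R[i]]_(m, n)) i j : cn2 (A i j) <= fro2 A.
Proof.
rewrite /fro2 (bigD1 i) //= (bigD1 j) //= -addrA lerDl addr_ge0 //.
  by apply: sumr_ge0 => ? _; apply: cn2_ge0.
by do 2![apply: sumr_ge0 => ? _]; apply: cn2_ge0.
Qed.

Lemma fro2_eq0 m n (A : 'M[R[i]]_(m, n)) : fro2 A <= 0 -> A = 0.
Proof.
move=> A0; apply/matrixP => i j; rewrite mxE; apply/eqP; rewrite -cn2_eq0 eq_le cn2_ge0.
by rewrite (le_trans (cn2_le_fro2 A i j)).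
Qed.

Lemma fro2_trace m n (A : 'M[R[i]]_(m, n)) : (fro2 A)%:C = \tr (adj A *m A).
Proof.
rewrite /fro2 exchange_big rmorph_sum; apply: eq_bigr => j _.
by rewrite mxE rmorph_sum; apply: eq_bigr => i _; rewrite adjE conjc_mul.
Qed.

Lemma fro2_adj m n (A : 'M[R[i]]_(m, n)) : fro2 (adj A) = fro2 A.
Proof.
rewrite /fro2 exchange_big; do 2![apply: eq_bigr => ? _]; by rewrite adjE cn2J.
Qed.

Lemma fro2Z m n (a : R) (A : 'M[R[i]]_(m, n)) : fro2 (a%:C *: A) = a ^+ 2 * fro2 A.
Proof.
rewrite mulr_sumr; apply: eq_bigr => i _; rewrite mulr_sumr; apply: eq_bigr => j _.
by rewrite mxE cn2M_real.
Qed.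

Lemma fro2_col m n (A : 'M[R[i]]_(m, n)) : fro2 A = \sum_j fro2 (col j A).
Proof.
rewrite /fro2 exchange_big; apply: eq_bigr => j _; apply: eq_bigr => i _.
by rewrite big_ord1 mxE.
Qed.

Lemma fro2_isometry m n p (U : 'M[R[i]]_(m, n)) (A : 'M[R[i]]_(n, p)) :
  adj U *m U = 1%:M -> fro2 (U *m A) = fro2 A.
Proof.
move=> UU; apply: (@complexI R); rewrite !fro2_trace adjM -mulmxA (mulmxA (adj U)).
by rewrite UU mul1mx.
Qed.

(* Convexity of the square, in the form that yields [l1 + l2] as the constant of a
   sum of two Lipschitz maps without square roots. *)
Lemma fro2D_le m n (A B : 'M[R[i]]_(m, n)) (l1 l2 D : R) :
  0 < l1 -> 0 < l2 -> fro2 A <= l1 ^+ 2 * D -> fro2 B <= l2 ^+ 2 * D ->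
  fro2 (A + B) <= (l1 + l2) ^+ 2 * D.
Proof.
move=> l10 l20 hA hB; have l0 : 0 < l1 + l2 by rewrite addr_gt0.
have sq (x y : R) : (x + y) ^+ 2 <= (l1 + l2) * (x ^+ 2 / l1 + y ^+ 2 / l2).
  rewrite -subr_ge0.
  have -> : (l1 + l2) * (x ^+ 2 / l1 + y ^+ 2 / l2) - (x + y) ^+ 2 =
            (l2 * x - l1 * y) ^+ 2 / (l1 * l2) by field; rewrite !gt_eqF.
  by rewrite divr_ge0 ?sqr_ge0 // mulr_ge0 // ltW.
have : fro2 (A + B) <= (l1 + l2) * (fro2 A / l1 + fro2 B / l2).
  rewrite /fro2 !mulr_suml -big_split mulr_sumr; apply: ler_sum => i _.
  rewrite /= !mulr_suml -big_split mulr_sumr; apply: ler_sum => j _.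
  rewrite mxE /cn2; case: (A i j) => a b; case: (B i j) => c d /=.
  apply: le_trans (lerD (sq a c) (sq b d)) _.
  by rewrite le_eqVlt; apply/orP; left; apply/eqP; field; rewrite !gt_eqF.
move/le_trans; apply; rewrite expr2 -mulrA ler_pM2l // mulrDl.
by apply: lerD; rewrite ler_pdivrMr // mulrAC -expr2.
Qed.

Section Spectral.
Variable n : nat.
Implicit Types (X Y H : 'M[R[i]]_n) (U V : 'M[R[i]]_n) (a b d : 'I_n -> R).
Implicit Types (v w : 'cV[R[i]]_n).

Definition rdiag d : 'M[R[i]]_n := diag_mx (\row_i (d i)%:C).
Definition udu U d : 'M[R[i]]_n := U *m rdiag d *m adj U.
Definition unimx U := adj U *m U = 1%:M.

Lemma unimxC U : unimx U -> U *m adj U = 1%:M.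
Proof. exact: mulmx1C. Qed.

Lemma adj_rdiag d : adj (rdiag d) = rdiag d.
Proof.
apply/matrixP => i j; rewrite !mxE; have [->|ij] := eqVneq i j.
  by rewrite ?eqxx !mulr1n conjc_real.
by rewrite !mulr0n conjc0.
Qed.

Lemma adj_udu U d : adj (udu U d) = udu U d.
Proof. by rewrite /udu !adjM adjK adj_rdiag mulmxA. Qed.

Lemma eq_udu U d d' : d =1 d' -> udu U d = udu U d'.
Proof.
by move=> dd; rewrite /udu /rdiag; congr (_ *m diag_mx _ *m _); apply/rowP => i; rewrite !mxE dd.
Qed.

Lemma rdiagM d d' : rdiag d *m rdiag d' = rdiag (fun i => d i * d' i).
Proof.
rewrite /rdiag mulmx_diag; congr diag_mx; apply/rowP => i.
by rewrite !mxE -rmorphM.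
Qed.

Lemma uduM U d d' : unimx U -> udu U d *m udu U d' = udu U (fun i => d i * d' i).
Proof.
by move=> UU; rewrite /udu -rdiagM !mulmxA -(mulmxA _ (adj U) U) UU mulmx1.
Qed.

Lemma udu_const U (c : R) : unimx U -> udu U (fun=> c) = c%:C%:M.
Proof.
move=> UU; rewrite /udu /rdiag.
have -> : \row_(i < n) c%:C = const_mx c%:C by apply/rowP => i; rewrite !mxE.
by rewrite diag_const_mx mul_mx_scalar -scalemxAl (unimxC UU) scalemx1.
Qed.

Definition spectral_real X i : R := complex.Re (spectral_diag X 0 i).

Definition fc (f : R -> R) X : 'M[R[i]]_n :=
  udu (adj (spectralmx X)) (f \o spectral_real X).

Lemma unimx_spectral X : unimx (adj (spectralmx X)).
Proof. by rewrite /unimx adjK; apply/unitarymxP/spectral_unitarymx. Qed.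

Lemma herm_spectralE X : adj X = X -> X = udu (adj (spectralmx X)) (spectral_real X).
Proof.
move=> hX; have hermX : X \is hermsymmx.
  by apply/is_hermitianmxP; rewrite expr0 scale1r -[LHS]hX.
have -> : udu (adj (spectralmx X)) (spectral_real X) =
          adj (spectralmx X) *m diag_mx (spectral_diag X) *m spectralmx X.
  rewrite /udu adjK /rdiag.
  have -> // : \row_i (spectral_real X i)%:C = spectral_diag X.
  apply/rowP => i; rewrite mxE RRe_real //.
  have /mxOverP := hermitian_spectral_diag_real hermX; exact.
have := orthomx_spectralP (hermitian_normalmx hermX).
by rewrite (invmx_unitary (spectral_unitarymx X)).
Qed.

Lemma herm_spectral X : adj X = X -> exists U d, unimx U /\ X = udu U d.
Proof.
move=> hX; exists (adj (spectralmx X)), (spectral_real X).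
by split; [exact: unimx_spectral | exact: herm_spectralE].
Qed.

(** Passing to U^* M V keeps the Frobenius norm, and the entry (i, j) becomes (a_i - b_j) times that
    of U^* V. These weights do not depend on the eigenvalues, so scalar inequalities transfer term
    by term. *)
Lemma fro2_udu_sub U V a b : unimx U -> unimx V ->
  fro2 (udu U a - udu V b) =
  \sum_i \sum_j (a i - b j) ^+ 2 * cn2 ((adj U *m V) i j).
Proof.
move=> UU VV.
have <- : fro2 (adj U *m (udu U a - udu V b) *m V) = fro2 (udu U a - udu V b).
  have uU : adj (adj U) *m adj U = 1%:M by rewrite adjK unimxC.
  have uV : adj (adj V) *m adj V = 1%:M by rewrite adjK unimxC.
  by rewrite -fro2_adj adjM (fro2_isometry _ uV) fro2_adj (fro2_isometry _ uU).
rewrite /udu mulmxBr mulmxBl !mulmxA UU mul1mx -!mulmxA VV mulmx1.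
rewrite [adj U *m (V *m _)]mulmxA; set W := adj U *m V.
do 2![apply: eq_bigr => ? _].
rewrite /rdiag mul_diag_mx mul_mx_diag !mxE mulrC -mulrBr -rmorphB mulrC.
exact: cn2M_real.
Qed.

Lemma fro2_udu_lip (f : R -> R) (L : R) U V a b : unimx U -> unimx V ->
  (forall i j, `|f (a i) - f (b j)| <= L * `|a i - b j|) ->
  fro2 (udu U (f \o a) - udu V (f \o b)) <= L ^+ 2 * fro2 (udu U a - udu V b).
Proof.
move=> UU VV fL; rewrite [leLHS](fro2_udu_sub _ _ UU VV).
rewrite (fro2_udu_sub _ _ UU VV) mulr_sumr; apply: ler_sum => i _.
rewrite mulr_sumr; apply: ler_sum => j _ /=; rewrite mulrA ler_wpM2r ?cn2_ge0 //.
rewrite -exprMn -real_normK ?num_real // -[leRHS]real_normK ?num_real //.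
rewrite lerXn2r ?nnegrE // (le_trans (fL i j)) // normrM ler_wpM2r //.
exact: ler_norm.
Qed.

(** Independence of the eigenbasis: a vanishing sum of nonnegative terms forces a_i = b_j wherever
    U^* V has a nonzero entry, and there [f] takes equal values. *)
Lemma udu_fun_eq (f : R -> R) U V a b : unimx U -> unimx V ->
  udu U a = udu V b -> udu U (f \o a) = udu V (f \o b).
Proof.
move=> UU VV E; apply/eqP; rewrite -subr_eq0; apply/eqP/fro2_eq0.
have := fro2_udu_sub a b UU VV; rewrite E subrr => /esym.
have -> : fro2 (0 : 'M[R[i]]_n) = 0.
  by rewrite -(scale0r (0 : 'M[R[i]]_n)) -[0%R]/(0%:C) fro2Z expr0n mul0r.
move=> s0; rewrite fro2_udu_sub // big1 // => i _; rewrite big1 // => j _.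
have := s0; move/psumr_eq0P => /(_ _ i isT) h.
have {}h : \sum_j (a i - b j) ^+ 2 * cn2 ((adj U *m V) i j) = 0.
  by apply: h => k _; apply: sumr_ge0 => l _; rewrite mulr_ge0 ?sqr_ge0 ?cn2_ge0.
move/psumr_eq0P: h => /(_ _ j isT) h.
have /eqP : (a i - b j) ^+ 2 * cn2 ((adj U *m V) i j) = 0.
  by apply: h => l _; rewrite mulr_ge0 ?sqr_ge0 ?cn2_ge0.
rewrite mulf_eq0 sqrf_eq0 subr_eq0 => /orP[/eqP ab|/eqP ->]; last by rewrite mulr0.
by rewrite /= ab subrr expr0n mul0r.
Qed.

Lemma fc_udu f U d : unimx U -> fc f (udu U d) = udu U (f \o d).
Proof.
move=> UU; apply: udu_fun_eq UU _; first exact: unimx_spectral.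
by rewrite -herm_spectralE ?adj_udu.
Qed.

Lemma fc_herm f X : adj (fc f X) = fc f X.
Proof. exact: adj_udu. Qed.

Lemma fc_lip (f : R -> R) (L : R) X Y : adj X = X -> adj Y = Y ->
  (forall x y, `|f x - f y| <= L * `|x - y|) ->
  fro2 (fc f X - fc f Y) <= L ^+ 2 * fro2 (X - Y).
Proof.
move=> /herm_spectral[U [a [UU ->]]] /herm_spectral[V [b [VV ->]]] fL.
rewrite (fc_udu _ _ UU) (fc_udu _ _ VV); exact: fro2_udu_lip.
Qed.

End Spectral.
End ComplexMatrices.

From mathcomp Require Import all_classical all_reals topology normedtype derive sequences exp.
(** * Fixed points of bounded Lipschitz maps *)

Import numFieldNormedType.Exports.

Section BoundedFixpoint.
Local Open Scope ring_scope.
Local Open Scope classical_set_scope.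
Variables (R : realType) (m : nat).
Implicit Types (x y : 'rV[R]_m).

Lemma mx_norm_rV_le x d : 0 <= d -> (forall j, `|x 0 j| <= d) -> `|x| <= d.
Proof.
move=> d0 h; rewrite [leLHS]/Num.norm /= mx_normrE; apply/bigmax_leP; split=> // -[i j] _ /=.
by rewrite (ord1 i).
Qed.

Lemma coord_le_mx_norm x j : `|x 0 j| <= `|x|.
Proof.
rewrite [leRHS]/Num.norm /= mx_normrE; apply/bigmax_geP; right => /=.
by exists (0, j).
Qed.

(** The displacement |G x - x| attains its minimum on a cube containing all mesh points, and the
    mesh estimate pushes that minimum below any positive number; no convergent subsequence has to be
    extracted. *)
Theorem bounded_lipschitz_fixpoint (G : 'rV[R]_m -> 'rV[R]_m) (M K : R) :
  0 < M -> 0 <= K -> (forall x j, `|G x 0 j| <= M) ->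
  (forall x y d, (forall j, `|x 0 j - y 0 j| <= d) ->
     forall j, `|G x 0 j - G y 0 j| <= K * d) ->
  exists x, G x = x.
Proof.
move=> M0 K0 Gb Glip; pose L := 2 * M * m.+1%:R.
have LM0 : 0 <= L + M by rewrite addr_ge0 ?mulr_ge0 ?ler0n // ltW.
pose A := [set v : 'rV[R]_m | forall i, `[- (L + M), L + M]%classic (v ord0 i)].
have cA : compact A.
  by apply: (@rV_compact _ _ (fun=> `[- (L + M), L + M]%classic)) => _; apply: segment_compact.
pose f x := `|G x - x|.
have flip x y : `|f x - f y| <= (K + 1) * `|x - y|.
  apply: le_trans (ler_dist_dist _ _) _.
  have -> : G x - x - (G y - y) = (G x - G y) - (x - y) 
    by rewrite !opprB [y - G y]addrC addrACA [- x + y]addrC.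
  apply: le_trans (ler_normB _ _) _; rewrite mulrDl mul1r lerD2r.
  apply: mx_norm_rV_le => [|j]; first by rewrite mulr_ge0.
  rewrite !mxE; apply: Glip => k.
  by have := coord_le_mx_norm (x - y) k; rewrite !mxE.
have cf : {within A, continuous f}.
  apply: continuous_subspaceT => x.
  apply/(@cvgrPdist_lt _ _ _ (nbhs x) (nbhs_filter x)) => e e0.
  near=> y; apply: le_lt_trans (flip x y) _.
  rewrite mulrC -ltr_pdivlMr ?ltr_wpDl //.
  near: y; apply: cvgr_dist_lt => //.
  by rewrite divr_gt0 // ltr_wpDl.
have A0 : A !=set0.
  exists 0 => i; rewrite /= mxE in_itv /= oppr_le0 LM0 //.
have [c cIn cmin] := compact_EVT_min A0 cA cf.
exists c; apply/eqP; rewrite -subr_eq0 -normr_le0 leNgt; apply/negP => fc0.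
pose B := L * (m.+1%:R * (K * m.+1%:R ^+ 2 + m.+1%:R)).
have B0 : 0 <= B by rewrite !mulr_ge0 ?addr_ge0 ?mulr_ge0 ?exprn_ge0 ?ler0n // ltW.
have [N NB] : exists N : nat, (B + 1) / `|G c - c| < N%:R.
  by exists (Num.truncn ((B + 1) / `|G c - c|)).+1; exact: truncnS_gt.
have N0 : (0 < N)%N.
  rewrite -(ltr_nat R); apply: le_lt_trans NB.
  by rewrite divr_ge0 ?addr_ge0.
have [x [xb xG]] := mesh_point M0 K0 Gb Glip N0.
have xA : x \in A.
  by rewrite inE => i; rewrite /= in_itv /= -ler_norml.
have := cmin x xA; rewrite leNgt => /negP; apply.
apply: le_lt_trans (_ : B / N%:R < _).
  apply: mx_norm_rV_le => [|j]; first by rewrite divr_ge0 ?ler0n.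
  by rewrite !mxE; apply: xG.
rewrite ltr_pdivrMr ?ltr0n //; move: NB; rewrite ltr_pdivrMr // [_ * `|_|]mulrC.
by apply: le_lt_trans; rewrite lerDl.
Unshelve. all: end_near.
Qed.

End BoundedFixpoint.

(** * Loewner order *)

Section LoewnerOrder.
Local Open Scope ring_scope.
Local Open Scope complex_scope.
Variables (R : rcfType) (n : nat).
Implicit Types (X Y U : 'M[R[i]]_n) (v w : 'cV[R[i]]_n) (d : 'I_n -> R).

Definition sesq v X w : R := complex.Re ((adj v *m X *m w) 0 0).
Definition qf X v : R := sesq v X v.
Definition ple X Y := forall v, qf X v <= qf Y v.

Lemma sesqDm v X Y w : sesq v (X + Y) w = sesq v X w + sesq v Y w.
Proof. by rewrite /sesq mulmxDr mulmxDl mxE ReD. Qed.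

Lemma sesqDl v v' X w : sesq (v + v') X w = sesq v X w + sesq v' X w.
Proof. by rewrite /sesq adjD !mulmxDl mxE ReD. Qed.

Lemma sesqDr v X w w' : sesq v X (w + w') = sesq v X w + sesq v X w'.
Proof. by rewrite /sesq mulmxDr mxE ReD. Qed.

Lemma sesqZm (a : R) v X w : sesq v (a%:C *: X) w = a * sesq v X w.
Proof. by rewrite /sesq -scalemxAr -scalemxAl mxE ReM_real. Qed.

Lemma sesqZl (a : R) v X w : sesq (a%:C *: v) X w = a * sesq v X w.
Proof. by rewrite /sesq adjZ -!scalemxAl mxE ReM_real. Qed.

Lemma sesqZr (a : R) v X w : sesq v X (a%:C *: w) = a * sesq v X w.
Proof. by rewrite /sesq -scalemxAr mxE ReM_real. Qed.

Lemma sesq_mulr v X Y w : sesq v (X *m Y) w = sesq v X (Y *m w).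
Proof. by rewrite /sesq !mulmxA. Qed.

Lemma sesq_mull v X Y w : sesq v (X *m Y) w = sesq (adj X *m v) Y w.
Proof. by rewrite /sesq adjM adjK !mulmxA. Qed.

Lemma sesqC v X w : sesq v X w = sesq w (adj X) v.
Proof.
rewrite /sesq; have -> : adj w *m adj X *m v = adj (adj v *m X *m w).
  by rewrite !adjM adjK mulmxA.
by rewrite adjE; case: (_ 0 0).
Qed.

Lemma sesq1 v w : sesq v 1%:M w = complex.Re ((adj v *m w) 0 0).
Proof. by rewrite /sesq mulmx1. Qed.

Lemma qf1 v : qf 1%:M v = fro2 v.
Proof.
rewrite /qf sesq1 mxE Re_sum; apply: eq_bigr => i _.
by rewrite big_ord1 adjE conjc_mul.
Qed.

Lemma qfD X Y v : qf (X + Y) v = qf X v + qf Y v. Proof. exact: sesqDm. Qed.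

Lemma qfZ (a : R) X v : qf (a%:C *: X) v = a * qf X v. Proof. exact: sesqZm. Qed.

Lemma qfN X v : qf (- X) v = - qf X v.
Proof.
by rewrite -scaleN1r (_ : -1 = (-1)%:C) ?qfZ ?mulN1r // rmorphN.
Qed.

Lemma qfB X Y v : qf (X - Y) v = qf X v - qf Y v.
Proof. by rewrite qfD qfN. Qed.

Lemma qf_scalar (a : R) v : qf (a%:C%:M) v = a * fro2 v.
Proof. by rewrite -scalemx1 qfZ qf1. Qed.

Lemma qf_conj A X v : qf (adj A *m X *m A) v = qf X (A *m v).
Proof. by rewrite /qf -mulmxA sesq_mull adjK sesq_mulr. Qed.

Lemma qf_udu U d v : qf (udu U d) v = \sum_i d i * cn2 ((adj U *m v) i 0).
Proof.
have -> : qf (udu U d) v = qf (rdiag d) (adj U *m v).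
  by rewrite -qf_conj adjK.
rewrite /qf /sesq -mulmxA mxE Re_sum; apply: eq_bigr => i _.
rewrite adjE /rdiag mul_diag_mx !mxE mulrCA conjc_mul.
by rewrite -rmorphM.
Qed.

Lemma udu_col U d i : unimx U -> udu U d *m col i U = (d i)%:C *: col i U.
Proof.
move=> UU; rewrite !colE /udu -!mulmxA (mulmxA (adj U)) UU mul1mx scalemxAr.
congr (_ *m _); apply/colP => k; rewrite /rdiag mul_diag_mx !mxE.
by have [->|] := eqVneq k i; rewrite ?mulr0.
Qed.

Lemma fro2_col_uni U i : unimx U -> fro2 (col i U) = 1.
Proof.
move=> UU; rewrite -qf1 /qf sesq1.
have -> : (adj (col i U) *m col i U) 0 0 = (adj U *m U) i i.
  by rewrite !mxE; apply: eq_bigr => j _; rewrite !mxE.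
by rewrite UU mxE eqxx.
Qed.

Lemma qf_udu_col U d i : unimx U -> qf (udu U d) (col i U) = d i.
Proof.
by move=> UU; rewrite /qf -[udu U d]mul1mx sesq_mulr udu_col // sesqZr -/(qf _ _)
  qf1 fro2_col_uni // mulr1.
Qed.

Lemma udu_ge U d c : unimx U -> (forall v, c * fro2 v <= qf (udu U d) v) ->
  forall i, c <= d i.
Proof.
move=> UU h i; have := h (col i U).
by rewrite (qf_udu_col _ _ UU) (fro2_col_uni _ UU) mulr1.
Qed.

Lemma udu_le U d c : unimx U -> (forall v, qf (udu U d) v <= c * fro2 v) ->
  forall i, d i <= c.
Proof.
move=> UU h i; have := h (col i U).
by rewrite (qf_udu_col _ _ UU) (fro2_col_uni _ UU) mulr1.
Qed.

Lemma ple_udu U d d' : (forall i, d i <= d' i) -> ple (udu U d) (udu U d').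
Proof.
move=> h v; rewrite !qf_udu; apply: ler_sum => i _.
by rewrite ler_wpM2r ?cn2_ge0.
Qed.

Lemma ge_udu U d c : unimx U -> (forall i, c <= d i) ->
  forall v, c * fro2 v <= qf (udu U d) v.
Proof. by move=> UU h v; rewrite -qf_scalar -(udu_const c UU); apply: ple_udu. Qed.

Lemma le_udu U d c : unimx U -> (forall i, d i <= c) ->
  forall v, qf (udu U d) v <= c * fro2 v.
Proof. by move=> UU h v; rewrite -qf_scalar -(udu_const c UU); apply: ple_udu. Qed.

Lemma fro2_vec_gt0 v : v != 0 -> 0 < fro2 v.
Proof.
move=> v0; rewrite lt_def fro2_ge0 andbT; apply: contra v0 => /eqP f0.
by rewrite (@fro2_eq0 _ _ _ v) // f0.
Qed.

Lemma sesq1_le v w : 2 * sesq v 1%:M w <= fro2 v + fro2 w.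
Proof.
have := fro2_ge0 (v + (-1)%:C *: w); rewrite -!qf1 /qf !(sesqDl, sesqDr, sesqZl, sesqZr).
have -> : sesq w 1%:M v = sesq v 1%:M w.
  rewrite sesqC; congr sesq; apply/matrixP => i j; rewrite !mxE.
  by rewrite eq_sym; case: eqP => _; rewrite ?conjc1 ?conjc0.
move: (sesq v 1%:M v) (sesq w 1%:M w) (sesq v 1%:M w) => a b c; lra.
Qed.

End LoewnerOrder.

(** * The Loewner-Heinz inequality *)

Section RealPowers.
Local Open Scope ring_scope.
Variable R : realType.

(** Mean value theorem: for r <= 1 the slope |r| z^(r-1) does not increase with z, so its value at
    [c] bounds it. This serves both the root 1/s and the negative powers. *)
Lemma powR_lip (r c x y : R) : r <= 1 -> 0 < c -> c <= x -> c <= y ->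
  `|x `^ r - y `^ r| <= `|r| * c `^ (r - 1) * `|x - y|.
Proof.
move=> r1 c0; wlog xy : x y / x <= y => [h cx cy|cx cy].
  by have [xy|/ltW yx] := leP x y; [exact: h | rewrite distrC [`|x - y|]distrC h].
have x0 : 0 < x by exact: lt_le_trans cx.
have y0 : 0 < y by exact: lt_le_trans xy.
have der z : x <= z -> is_derive z 1 (@powR R ^~ r) (r * z `^ (r - 1)).
  by move=> xz; apply: is_derive1_powR; apply: lt_le_trans xz.
have [|//||z] := @MVT_segment R (@powR R ^~ r) (fun z => r * z `^ (r - 1)) x y.
- by [].
- by move=> z; rewrite in_itv /= => /andP[/ltW xz _]; apply: der.
- apply: derivable_within_continuous => z; rewrite in_itv /= => /andP[xz _].
  by have [] := der z xz.
rewrite in_itv /= => /andP[xz zy] E; rewrite distrC E normrM [`|x - y|]distrC.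
rewrite ler_wpM2r // normrM ler_wpM2l // (ger0_norm (powR_ge0 _ _)).
have z0 : 0 < z by exact: lt_le_trans xz.
have cz : c <= z by exact: le_trans xz.
have : 0 <= 1 - r by rewrite subr_ge0.
rewrite -(opprB 1 r); move: (1 - r) => q q0; rewrite !powRN lef_pV2 ?posrE ?powR_gt0 //.
by apply: (ge0_ler_powR q0); rewrite ?nnegrE //; apply: ltW.
Qed.

End RealPowers.

Section LoewnerHeinz.
Local Open Scope ring_scope.
Local Open Scope complex_scope.
Variables (R : realType) (n : nat).
Implicit Types (X Y U V W : 'M[R[i]]_n) (v w : 'cV[R[i]]_n) (a b d : 'I_n -> R).

Definition upow U d (r : R) : 'M[R[i]]_n := udu U (fun i => d i `^ r).

Lemma upowD U d r s : unimx U -> (forall i, 0 < d i) ->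
  upow U d r *m upow U d s = upow U d (r + s).
Proof.
move=> UU d0; rewrite /upow (uduM _ _ UU); apply: eq_udu => i.
by rewrite powRD //; apply/implyP => _; rewrite gt_eqF.
Qed.

Lemma upow0 U d : unimx U -> upow U d 0 = 1%:M.
Proof.
by move=> UU; rewrite /upow -[1]/(1%:C) -(udu_const 1 UU); apply: eq_udu => i; rewrite powRr0.
Qed.

Lemma upow1 U d : (forall i, 0 < d i) -> upow U d 1 = udu U d.
Proof. by move=> d0; apply: eq_udu => i; rewrite powRr1 // ltW. Qed.

Lemma upow_herm U d r : adj (upow U d r) = upow U d r.
Proof. exact: adj_udu. Qed.

Lemma fro2_upow_half U d r v : unimx U -> (forall i, 0 < d i) ->
  fro2 (upow U d (r / 2) *m v) = qf (upow U d r) v.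
Proof.
move=> UU d0; rewrite -qf1 -qf_conj upow_herm mulmx1 (upowD _ _ UU d0).
by rewrite -splitr.
Qed.

(** With Y = [udu V b], the Hermitian matrix Y^(-1/2) X Y^(-1/2) has its eigenvalues among these
    [mu], with y = Y^(-1/2) w for an eigenvector w. Once they are at most 1, congruence by Y^(1/2)
    gives X <= Y. *)
Lemma ple_of_eigen V b X : unimx V -> (forall i, 0 < b i) -> adj X = X ->
  (forall mu (y : 'cV[R[i]]_n), y != 0 -> X *m y = mu%:C *: (udu V b *m y) -> mu <= 1) ->
  ple X (udu V b).
Proof.
move=> VV b0 hX eig.
have [P [PP P0 P1 Pa]] : exists P : R -> 'M[R[i]]_n,
    [/\ forall r s, P r *m P s = P (r + s), P 0 = 1%:M, P 1 = udu V b &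
        forall r, adj (P r) = P r].
  exists (upow V b); split=> [r s||| r].
  - exact: upowD.
  - exact: upow0.
  - exact: upow1.
  - exact: upow_herm.
pose h : R := 1 / 2; have hh : h + h = 1 by rewrite /h -splitr.
have hM : adj (P (- h) *m X *m P (- h)) = P (- h) *m X *m P (- h).
  by rewrite !adjM hX Pa mulmxA.
have [W [m [WW ME]]] := herm_spectral hM.
have XE : X = P h *m (P (- h) *m X *m P (- h)) *m P h.
  by rewrite !mulmxA PP subrr P0 mul1mx -mulmxA PP addNr P0 mulmx1.
have m1 i : m i <= 1.
  apply: (eig _ (P (- h) *m col i W)).
    apply/eqP => y0; have := fro2_col_uni i WW.
    rewrite -[col i W]mul1mx -P0 -(subrr h) -PP -mulmxA y0 mulmx0.
    by rewrite -qf1 /qf /sesq mulmx0 mxE => /eqP; rewrite eq_sym oner_eq0.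
  rewrite -P1 [in RHS]mulmxA PP -hh addrK.
  have -> : X *m (P (- h) *m col i W) = P h *m (P (- h) *m X *m P (- h) *m col i W).
    by rewrite {1}XE -!mulmxA (mulmxA (P h) (P (- h)) (col i W)) PP subrr P0 mul1mx.
  by rewrite ME udu_col // -scalemxAr.
have Xq v : qf X v = qf (udu W m) (P h *m v).
  by rewrite {1}XE -{1}(Pa h) ME qf_conj.
move=> v; rewrite Xq -P1 -hh -PP.
have -> : P h *m P h = adj (P h) *m 1%:M *m P h by rewrite Pa mulmx1.
rewrite qf_conj qf1 -[leRHS]mul1r.
exact: le_udu.
Qed.

Section Midpoint.
Variables (U V : 'M[R[i]]_n) (a b : 'I_n -> R).
Hypotheses (UU : unimx U) (VV : unimx V).
Hypotheses (a0 : forall i, 0 < a i) (b0 : forall i, 0 < b i).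

(* Pedersen's argument: for an eigenvector [X^c y = mu Y^c y], [c = (r + s) / 2], pair both
   sides with [Y^((s - r) / 2) y] and apply Cauchy-Schwarz to [X^(r/2)] and [X^(s/2)]. *)
Lemma ple_upow_midpoint r s :
  ple (upow U a r) (upow V b r) -> ple (upow U a s) (upow V b s) ->
  ple (upow U a ((r + s) / 2)) (upow V b ((r + s) / 2)).
Proof.
move=> hr hs; apply: ple_of_eigen => // [i||mu y y0 E]; first exact: powR_gt0.
  exact: upow_herm.
rewrite -/(upow V b _) in E.
set T := upow V b ((s - r) / 2); pose z := T *m y.
have qpos : 0 < qf (upow V b s) y.
  rewrite -(fro2_upow_half s y VV b0); apply: fro2_vec_gt0; apply/eqP => z0.
  move/eqP: y0; apply; rewrite -[y]mul1mx -(upow0 b VV) -(addNr (s / 2)) -(upowD _ _ VV b0).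
  by rewrite -mulmxA z0 mulmx0.
have zE : qf (upow V b r) z = qf (upow V b s) y.
  rewrite /z -qf_conj upow_herm /T !(upowD _ _ VV b0).
  have -> // : (s - r) / 2 + r + (s - r) / 2 = s by lra.
have e1 : sesq z (upow V b ((r + s) / 2)) y = qf (upow V b s) y.
  rewrite /z /T -{1}(upow_herm V b ((s - r) / 2)) -sesq_mull (upowD _ _ VV b0).
  have -> // : (s - r) / 2 + (r + s) / 2 = s by lra.
(* The choice of [z] bounds both terms of 2 Re <u, w> <= |u|^2 + |w|^2 by the same
   [qf (upow V b s) y], so this form is as good as Cauchy-Schwarz. *)
have e2 : 2 * sesq z (upow U a ((r + s) / 2)) y <= 2 * qf (upow V b s) y.
  rewrite [(r + s) / 2]mulrDl -(upowD _ _ UU a0) sesq_mull upow_herm.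
  rewrite -[upow U a (s / 2)]mul1mx sesq_mulr.
  apply: le_trans (sesq1_le _ _) _; rewrite (fro2_upow_half _ _ UU a0) (fro2_upow_half _ _ UU a0).
  have := hr z; have := hs y; rewrite zE => h1 h2; rewrite mulr2n mulrDl mul1r.
  exact: lerD.
have two0 : 0 < 2 :> R by rewrite ltr0n.
move: e2; rewrite (ler_pM2l two0).
have -> : sesq z (upow U a ((r + s) / 2)) y = mu * qf (upow V b s) y.
  rewrite -e1 -sesqZr -[upow U a _]mul1mx sesq_mulr E.
  by rewrite -[X in _ = sesq _ X _]mul1mx [RHS]sesq_mulr -scalemxAr.
by rewrite -[leRHS]mul1r ler_pM2r.
Qed.

Hypothesis hab : ple (udu U a) (udu V b).

(** An odd numerator makes the exponent the midpoint of two neighbours with denominator 2^k; an even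
    one reduces the fraction. *)
Lemma ple_upow_dyadic k j : (j <= 2 ^ k)%N ->
  ple (upow U a (j%:R / 2 ^+ k)) (upow V b (j%:R / 2 ^+ k)).
Proof.
elim: k j => [|k IH] j.
  rewrite expr0 divr1; case: j => [|[|j jk]]; last by exfalso.
  - move=> _ v; by rewrite (upow0 _ UU) (upow0 _ VV) lexx.
  - by move=> _ v; rewrite (upow1 _ a0) (upow1 _ b0) hab.
move=> jk; have [jo|je] := boolP (odd j).
  have E : j = (j./2 + j./2.+1)%N by rewrite addnS addnn -[LHS]odd_double_half jo.
  have -> : j%:R / 2 ^+ k.+1 = (j./2%:R / 2 ^+ k + j./2.+1%:R / 2 ^+ k) / 2 :> R.
    by rewrite {1}E natrD exprS; field; rewrite expf_neq0 ?pnatr_eq0.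
  have j2 : (j./2 < 2 ^ k)%N.
    by rewrite -(ltn_pmul2l (isT : 0 < 2)%N) -expnS mul2n (leq_trans _ jk) // [leqRHS]E addnS addnn.
  by apply: ple_upow_midpoint; apply: IH => //; apply: ltnW.
have -> : j%:R / 2 ^+ k.+1 = j./2%:R / 2 ^+ k :> R.
  rewrite -[in LHS](odd_double_half j) (negbTE je) add0n -mul2n natrM exprS.
  by field; rewrite expf_neq0 ?pnatr_eq0.
apply: IH; rewrite -(leq_pmul2l (isT : 0 < 2)%N) -expnS mul2n.
by rewrite even_halfK.
Qed.

(** For fixed [v] the difference of the two forms is continuous in the exponent; if negative at [r],
    it would be negative at a nearby dyadic exponent. *)
Theorem loewner_heinz r : 0 <= r <= 1 -> ple (upow U a r) (upow V b r).
Proof.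
move=> /andP[r0 r1] v; rewrite leNgt; apply/negP => lt.
pose g (x : R) := qf (upow V b x) v - qf (upow U a x) v.
have powc (c : R) : 0 < c -> {for r, continuous (fun x : R => c `^ x)}.
  move=> c0; have -> : (fun x : R => c `^ x) = (fun x => expR (x * ln c)).
    by apply/funext => x; rewrite /powR gt_eqF.
  apply: continuous_comp; last exact: continuous_expR.
  exact: mulrr_continuous.
have sumc W d : (forall i, 0 < d i) -> {for r, continuous (fun x : R => qf (upow W d x) v)}.
  move=> d0; have -> : (fun x : R => qf (upow W d x) v) =
      (fun x => \sum_i (d i `^ x * cn2 ((adj W *m v) i 0))).
    by apply/funext => x; rewrite qf_udu.
  rewrite /prop_for /continuous_at; elim: (index_enum _) => [|i s IH].
    under eq_cvg do rewrite big_nil.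
    by rewrite big_nil; exact: cvg_cst.
  under eq_cvg do rewrite big_cons.
  by rewrite big_cons; apply: cvgD => //; apply: cvgMl; exact: powc.
have gc : {for r, continuous g} by apply: cvgB; apply: sumc.
have gr : g r < 0 by rewrite subr_lt0.
move/cvgrPdist_lt: gc => /(_ (- g r)); rewrite oppr_gt0 => /(_ gr) /nbhs_ballP[e /= e0 he].
have [k ke] : exists k, e^-1 < 2 ^+ k.
  exists (Num.truncn e^-1).+1; apply: lt_le_trans (truncnS_gt _) _.
  by rewrite -natrX ler_nat ltnW // ltn_expl.
have p0 : 0 < 2 ^+ k :> R by rewrite exprn_gt0.
have rp0 : 0 <= r * 2 ^+ k by rewrite mulr_ge0 // ltW.
pose j := Num.truncn (r * 2 ^+ k).
have /andP[jl ju] := truncn_itv rp0; rewrite -/j in jl ju.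
have jle : (j <= 2 ^ k)%N.
  by rewrite -(ler_nat R) natrX (le_trans jl) // ler_piMl // ltW.
have bj : ball r e (j%:R / 2 ^+ k).
  rewrite /ball /= ger0_norm ?subr_ge0 ?ler_pdivrMr //.
  rewrite -(ltr_pM2r p0) mulrBl divfK ?gt_eqF // ltrBlDl.
  apply: lt_le_trans ju _; rewrite -natr1 lerD2l -ler_pdivrMl // mulr1.
  exact: ltW.
have := he _ bj; rewrite /= ltr_norml => /andP[h1 _].
have := ple_upow_dyadic jle v; rewrite -subr_ge0 -/(g _) => h2.
by move: h1; rewrite opprK ltrDl oppr_gt0 ltNge h2.
Qed.

End Midpoint.
End LoewnerHeinz.

(** * Fixed points of matrix maps *)

Section MatrixFixpoint.
Local Open Scope ring_scope.
Local Open Scope complex_scope.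
Variables (R : realType) (n : nat).

Definition real_coords := #|{: 'I_n * 'I_n * bool}|.

Definition mx_of_coords (x : 'rV[R]_real_coords) : 'M[R[i]]_n :=
  \matrix_(i, j) (x 0 (enum_rank (i, j, false)) +i* x 0 (enum_rank (i, j, true))).

Definition coords_of_mx (Z : 'M[R[i]]_n) : 'rV[R]_real_coords :=
  \row_k (let: (i, j, b) := enum_val k in
          if b then complex.Im (Z i j) else complex.Re (Z i j)).

Lemma coords_of_mxK : cancel coords_of_mx mx_of_coords.
Proof.
by move=> Z; apply/matrixP => i j; rewrite !mxE !enum_rankK; case: (Z i j).
Qed.

Lemma coords_of_mxB Z Z' k :
  coords_of_mx Z 0 k - coords_of_mx Z' 0 k = coords_of_mx (Z - Z') 0 k.
Proof.
rewrite !mxE; case: (enum_val k) => -[i j] b; rewrite !mxE.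
by case: b; case: (Z i j) => ? ?; case: (Z' i j).
Qed.

Lemma coord_sqr_le Z k : `|coords_of_mx Z 0 k| ^+ 2 <= fro2 Z.
Proof.
rewrite real_normK ?num_real // mxE; case: (enum_val k) => -[i j] b.
apply: le_trans (cn2_le_fro2 Z i j); rewrite /cn2; case: b.
  by rewrite lerDr sqr_ge0.
by rewrite lerDl sqr_ge0.
Qed.

Lemma fro2_mx_of_coords_le (x y : 'rV[R]_real_coords) (e : R) : (forall k, `|x 0 k - y 0 k| <= e) ->
  fro2 (mx_of_coords x - mx_of_coords y) <= (2 * n ^ 2)%:R * e ^+ 2.
Proof.
move=> h; have sq k : (x 0 k - y 0 k) ^+ 2 <= e ^+ 2.
  rewrite -[leLHS]real_normK ?num_real // lerXn2r ?nnegrE //.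
  by rewrite (le_trans _ (h k)).
apply: le_trans (_ : \sum_(i < n) \sum_(j < n) (2 * e ^+ 2) <= _).
  do 2![apply: ler_sum => ? _]; rewrite !mxE /cn2 /= mulrDl mul1r.
  by apply: lerD; apply: sq.
rewrite !sumr_const !card_ord -mulrnA natrM natrX -[_ *+ (n * n)]mulr_natr natrM.
by rewrite le_eqVlt; apply/orP; left; apply/eqP; ring.
Qed.

(** [M] and [K] bound squared norms. Enlarging them avoids square roots: M <= (M+1)^2, and 2 n^2 K
    <= K'^2 because K' >= 1. The factor 2 n^2 is the number of real coordinates. *)
Theorem mx_bounded_lipschitz_fixpoint (G : 'M[R[i]]_n -> 'M[R[i]]_n) (M K : R) :
  0 <= M -> 0 <= K -> (forall Z, fro2 (G Z) <= M) ->
  (forall Z Z', fro2 (G Z - G Z') <= K * fro2 (Z - Z')) ->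
  exists X, G X = X.
Proof.
move=> M0 K0 GM GK; pose g x := coords_of_mx (G (mx_of_coords x)).
pose K' := K * (2 * n ^ 2)%:R + 1.
have K1 : 0 <= K * (2 * n ^ 2)%:R by rewrite mulr_ge0.
have K'1 : 1 <= K' by rewrite lerDr.
have sqr_le (x y : R) : 0 <= x -> 0 <= y -> x ^+ 2 <= y ^+ 2 -> x <= y.
  by move=> x0 y0; rewrite ler_pXn2r ?nnegrE.
have [||x k|x y e h k|x gx] := @bounded_lipschitz_fixpoint R _ g (M + 1) K'.
- by rewrite ltr_wpDl.
- exact: le_trans K'1.
- apply: sqr_le; rewrite ?addr_ge0 //; apply: le_trans (coord_sqr_le _ _) _.
  apply: le_trans (GM _) _; rewrite sqrrD mulr1 expr1n.
  have : 0 <= M ^+ 2 by rewrite sqr_ge0.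
  by move: M0; move: (M ^+ 2) => u; rewrite mulr2n; clear; lra.
- have e0 : 0 <= e by rewrite (le_trans _ (h k)).
  apply: sqr_le; rewrite ?mulr_ge0 ?(le_trans _ K'1) // coords_of_mxB.
  apply: le_trans (coord_sqr_le _ _) _; apply: le_trans (GK _ _) _.
  apply: le_trans (ler_wpM2l K0 (fro2_mx_of_coords_le h)) _.
  rewrite mulrA exprMn ler_wpM2r ?sqr_ge0 //.
  apply: le_trans (_ : K' <= _); first by rewrite lerDl.
  by rewrite expr2 ler_peMr // (le_trans _ K'1).
exists (mx_of_coords x); rewrite -[RHS](congr1 mx_of_coords gx).
by rewrite coords_of_mxK.
Qed.

End MatrixFixpoint.

(** * Frobenius bounds for D |-> A^* D A *)

Section Sandwich.
Local Open Scope ring_scope.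
Local Open Scope complex_scope.
Variables (R : rcfType) (n : nat).
Implicit Types (A B D : 'M[R[i]]_n) (v w : 'cV[R[i]]_n).

(** With u = A^* w one has |u|^2 = <w, A u>. Scaling [w] by [a] balances 2 <a w, A u> <= a^2 |w|^2 +
    |A u|^2: the last term is at most a |u|^2, half of the left side. *)
Lemma adj_bound A (a : R) : 0 < a -> (forall v, fro2 (A *m v) <= a * fro2 v) ->
  forall w, fro2 (adj A *m w) <= a * fro2 w.
Proof.
move=> a0 hA w; set u := adj A *m w.
have e1 : sesq w 1%:M (A *m u) = fro2 u.
  by rewrite sesq1 -qf1 /qf sesq1 /u adjM adjK mulmxA.
have := sesq1_le (a%:C *: w) (A *m u); rewrite sesqZl e1 fro2Z => h.
have {}h := le_trans h (lerD (lexx _) (hA u)).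
rewrite -(ler_pM2l a0); move: h; rewrite mulr_natl mulr2n.
by rewrite lerD2r mulrA -expr2.
Qed.

Lemma fro2_mull_le A (a : R) D : (forall v, fro2 (A *m v) <= a * fro2 v) ->
  fro2 (A *m D) <= a * fro2 D.
Proof.
move=> hA; rewrite !fro2_col mulr_sumr; apply: ler_sum => j _.
by rewrite colE -mulmxA -colE.
Qed.

(** [a] bounds the squared spectral norm of [A] and, by [adj_bound], of its adjoint. Each of the two
    multiplications acts column by column and costs one factor [a]. *)
Lemma fro2_sandwich_le A (a : R) D : 0 < a -> (forall v, fro2 (A *m v) <= a * fro2 v) ->
  fro2 (adj A *m D *m A) <= a ^+ 2 * fro2 D.
Proof.
move=> a0 hA; have hA' := adj_bound a0 hA.
rewrite -fro2_adj adjM; apply: le_trans (fro2_mull_le _ hA') _.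
rewrite fro2_adj expr2 -mulrA (ler_pM2l a0); exact: fro2_mull_le.
Qed.

Lemma fro2_sandwichD_le A B D E (a b l m F : R) :
  0 < a -> (forall v, fro2 (A *m v) <= a * fro2 v) ->
  0 < b -> (forall v, fro2 (B *m v) <= b * fro2 v) ->
  0 < l -> 0 < m -> fro2 D <= l ^+ 2 * F -> fro2 E <= m ^+ 2 * F ->
  fro2 (adj A *m D *m A + adj B *m E *m B) <= (l * a + m * b) ^+ 2 * F.
Proof.
move=> a0 hA b0 hB l0 m0 hD hE; apply: fro2D_le; rewrite ?mulr_gt0 //.
  apply: le_trans (fro2_sandwich_le _ a0 hA) _.
  by rewrite exprMn [l ^+ 2 * _]mulrC -[_ * F]mulrA (ler_pM2l (exprn_gt0 2 a0)).
apply: le_trans (fro2_sandwich_le _ b0 hB) _.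
by rewrite exprMn [m ^+ 2 * _]mulrC -[_ * F]mulrA (ler_pM2l (exprn_gt0 2 b0)).
Qed.

End Sandwich.

(** * The matrix equation *)

Section MatrixEquation.
Local Open Scope ring_scope.
Local Open Scope complex_scope.
Variables (R : realType) (n : nat).
Implicit Types (X Y Z U V W : 'M[R[i]]_n) (v w : 'cV[R[i]]_n) (d : 'I_n -> R).

Definition clip_pow (c r x : R) : R := Num.max x c `^ r.

Lemma clip_pow_lip c r x y : r <= 1 -> 0 < c ->
  `|clip_pow c r x - clip_pow c r y| <= `|r| * c `^ (r - 1) * `|x - y|.
Proof.
move=> r1 c0; have maxc z : c <= Num.max z c by rewrite le_max lexx orbT.
apply: le_trans (powR_lip r1 c0 (maxc x) (maxc y)) _.
rewrite ler_wpM2l ?mulr_ge0 ?powR_ge0 //.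
have [xc|/ltW xc] := leP x c; have [yc|/ltW yc] := leP y c.
- by rewrite subrr normr0.
- by rewrite distrC [leRHS]distrC !ger0_norm ?subr_ge0 ?lerB // (le_trans xc).
- by rewrite !ger0_norm ?subr_ge0 ?lerB // (le_trans yc).
- by [].
Qed.

Lemma clip_pow_ge0 c r x : 0 <= clip_pow c r x.
Proof. exact: powR_ge0. Qed.

(** Retracts all matrices onto the Hermitian ones without increasing Frobenius distances, so that
    the fixed-point map is Lipschitz on the whole space. *)
Definition hpart Z : 'M[R[i]]_n := (2^-1)%:C *: (Z + adj Z).

Lemma hpart_herm Z : adj (hpart Z) = hpart Z.
Proof. by rewrite /hpart adjZ adjD adjK addrC. Qed.

Lemma hpart_id Z : adj Z = Z -> hpart Z = Z.
Proof.
move=> hZ; rewrite /hpart hZ; apply/matrixP => i j; rewrite !mxE.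
case: (Z i j) => x y; apply/eqP; rewrite eq_complex /=.
by apply/andP; split; apply/eqP; field.
Qed.

Lemma hpart_lip Z Z' : fro2 (hpart Z - hpart Z') <= fro2 (Z - Z').
Proof.
have -> : hpart Z - hpart Z' = (2^-1)%:C *: (Z - Z') + (2^-1)%:C *: adj (Z - Z').
  by rewrite /hpart -scalerBr -scalerDr adjB opprD addrACA.
have hh : 2^-1 + 2^-1 = 1 :> R by field.
have h0 : 0 < 2^-1 :> R by rewrite invr_gt0 ltr0n.
have := @fro2D_le _ _ _ ((2^-1)%:C *: (Z - Z')) ((2^-1)%:C *: adj (Z - Z')) _ _
  (fro2 (Z - Z')) h0 h0.
by rewrite hh expr1n mul1r !fro2Z fro2_adj; apply.
Qed.

Lemma fro2_udu_le U d (m : R) : unimx U -> (forall i, `|d i| <= m) ->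
  fro2 (udu U d) <= m ^+ 2 * fro2 (1%:M : 'M[R[i]]_n).
Proof.
move=> UU dm; have -> : udu U d = udu U d - udu U (fun=> 0).
  by rewrite (udu_const _ UU) -scalemx1 -[real_complex R 0]/(0 : R[i]) scale0r subr0.
rewrite (fro2_udu_sub _ _ UU UU) UU mulr_sumr; apply: ler_sum => i _.
rewrite mulr_sumr; apply: ler_sum => j _; rewrite ler_wpM2r ?cn2_ge0 // subr0.
rewrite -[leLHS]real_normK ?num_real // lerXn2r ?nnegrE //.
by rewrite (le_trans _ (dm i)).
Qed.

Lemma eqn_sub (A B Q X X' T T' P P' : 'M[R[i]]_n) :
  X + (adj A *m T *m A + adj B *m P *m B) = Q ->
  X' + (adj A *m T' *m A + adj B *m P' *m B) = Q ->
  adj A *m (T - T') *m A + adj B *m (P - P') *m B = - (X - X').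
Proof.
rewrite !mulmxBr !mulmxBl => e1 e2; rewrite addrACA -opprD.
have -> : adj A *m T *m A + adj B *m P *m B = Q - X by rewrite -e1 addrAC subrr add0r.
have -> : adj A *m T' *m A + adj B *m P' *m B = Q - X' by rewrite -e2 addrAC subrr add0r.
by rewrite !opprB addrC addrA subrK.
Qed.

Section Equation.
Variables (A B Q : 'M[R[i]]_n) (s t p c : R).
Hypotheses (s1 : 1 <= s) (t1 : 1 <= t) (p1 : 1 <= p) (c0 : 0 < c).

Let s0 : 0 < s. Proof. exact: lt_le_trans s1. Qed.
Let t0 : 0 < t. Proof. exact: lt_le_trans t1. Qed.
Let p0 : 0 < p. Proof. exact: lt_le_trans p1. Qed.
Let cs0 : 0 < c `^ s. Proof. exact: powR_gt0. Qed.
Let s'1 : 1 / s <= 1. Proof. by rewrite ler_pdivrMr // mul1r. Qed.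

Let s'0 : 0 < 1 / s. Proof. by rewrite divr_gt0. Qed.

(** Multiplied by 1/s this is the slope of x^(1/s) at c^s, the outer factor of the uniqueness
    condition. *)
Let root_slope : (c `^ s) `^ (1 / s - 1) = c `^ (1 - s).
Proof. by rewrite -powRrM mulrBr mulr1 mulrC divfK ?gt_eqF. Qed.

Definition eqn_solution U d :=
  upow U d s + (adj A *m upow U d (- t) *m A + adj B *m upow U d (- p) *m B) = Q.

(** The absolute slope of x^(-r) at [c], that is r / c^(r+1): the coefficients in the bracket of the
    uniqueness condition. *)
Definition lip_inv (r : R) : R := r * c `^ (- r - 1).

Let lip_inv_gt0 r : 0 < r -> 0 < lip_inv r.
Proof. by move=> r0; rewrite mulr_gt0 // powR_gt0. Qed.

Let powN_lip r x y : 0 < r -> c <= x -> c <= y ->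
  `|x `^ (- r) - y `^ (- r)| <= lip_inv r * `|x - y|.
Proof.
move=> r0 cx cy; have := @powR_lip R (- r) c x y.
rewrite normrN (gtr0_norm r0); apply=> //.
by rewrite (le_trans _ ler01) // oppr_le0 ltW.
Qed.

(** Taking roots bounds |X - X'| by [L] |X^s - X'^s|, and the equation expresses X^s - X'^s through
    the negative powers, which gives at most [S] |X - X'|. With [L * S] below 1 the distance
    vanishes. *)
Lemma eqn_solution_unique U d U' d' (a b : R) :
  unimx U -> unimx U' -> (forall i, c <= d i) -> (forall i, c <= d' i) ->
  eqn_solution U d -> eqn_solution U' d' ->
  0 < a -> (forall v, fro2 (A *m v) <= a * fro2 v) ->
  0 < b -> (forall v, fro2 (B *m v) <= b * fro2 v) ->
  1 / s * c `^ (1 - s) * (lip_inv t * a + lip_inv p * b) < 1 ->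
  udu U d = udu U' d'.
Proof.
move=> UU UU' cd cd' e1 e2 a0 hA b0 hB lt1.
have d0 i : 0 < d i by exact: lt_le_trans (cd i).
have d0' i : 0 < d' i by exact: lt_le_trans (cd' i).
pose L := 1 / s * c `^ (1 - s).
have root W e : (forall i, 0 < e i) ->
    udu W e = udu W ((fun x => x `^ (1 / s)) \o (fun i => e i `^ s)).
  move=> e0; apply: eq_udu => i /=.
  by rewrite -powRrM mulrC divfK ?gt_eqF // powRr1 // ltW.
have h1 : fro2 (udu U d - udu U' d') <= L ^+ 2 * fro2 (upow U d s - upow U' d' s).
  rewrite {1}(root _ _ d0) {1}(root _ _ d0'); apply: fro2_udu_lip => // i j.
  have cs e : c <= e -> c `^ s <= e `^ s.
    move=> ce; apply: (ge0_ler_powR (ltW s0)); rewrite ?nnegrE //; first exact: ltW.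
    by apply: ltW; apply: lt_le_trans ce.
  have := powR_lip s'1 cs0 (cs _ (cd i)) (cs _ (cd' j)).
  rewrite root_slope (ger0_norm (ltW s'0)); exact.
have hD r : 0 < r -> fro2 (upow U d (- r) - upow U' d' (- r)) <=
    lip_inv r ^+ 2 * fro2 (udu U d - udu U' d').
  move=> r0; apply: (@fro2_udu_lip _ _ (fun x => x `^ (- r))) => // i j.
  exact: powN_lip.
have := fro2_sandwichD_le a0 hA b0 hB (lip_inv_gt0 t0) (lip_inv_gt0 p0) (hD t t0) (hD p p0).
rewrite (eqn_sub e1 e2).
have -> : - (upow U d s - upow U' d' s) = (-1)%:C *: (upow U d s - upow U' d' s).
  by rewrite rmorphN rmorph1 scaleN1r.
rewrite fro2Z sqrrN expr1n mul1r => h2.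
set S := lip_inv t * a + lip_inv p * b in h2 lt1.
have S0 : 0 < S := addr_gt0 (mulr_gt0 (lip_inv_gt0 t0) a0) (mulr_gt0 (lip_inv_gt0 p0) b0).
have L0 : 0 < L by rewrite mulr_gt0 ?powR_gt0 ?divr_gt0.
have h3 : fro2 (udu U d - udu U' d') <= (L * S) ^+ 2 * fro2 (udu U d - udu U' d').
  apply: le_trans h1 _; rewrite [(L * S) ^+ 2]exprMn -[leRHS]mulrA (ler_pM2l (exprn_gt0 2 L0)).
  exact: h2.
apply/eqP; rewrite -subr_eq0; apply/eqP/fro2_eq0; rewrite leNgt; apply/negP => f0.
move: h3; rewrite -[leLHS]mul1r (ler_pM2r f0) leNgt => /negP; apply.
by rewrite (expr_lt1 _ (ltW (mulr_gt0 L0 S0))).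
Qed.

Section Existence.
Variables (V : 'M[R[i]]_n) (q : 'I_n -> R) (al be : R).
Hypotheses (VV : unimx V) (q0 : forall i, 0 < q i) (QE : Q = udu V q).
Hypotheses (al0 : 0 <= al) (be0 : 0 <= be).
Hypothesis hA : forall v, fro2 (A *m v) <= al * qf Q v.
Hypothesis hB : forall v, fro2 (B *m v) <= be * qf Q v.
Hypothesis hc : forall v,
  c `^ s * fro2 v <= (1 - al * c `^ (- t) - be * c `^ (- p)) * qf Q v.

Let rest Z : 'M[R[i]]_n :=
  adj A *m fc (clip_pow c (- t)) (hpart Z) *m A + adj B *m fc (clip_pow c (- p)) (hpart Z) *m B.

(** The outer clip at c^s puts every value of [step] above c I, exactly the level from which the
    inner clips in [rest] are inactive. *)
Let step Z := fc (clip_pow (c `^ s) (1 / s)) (Q - rest Z).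

Let sandwich_herm (D M : 'M[R[i]]_n) : adj D = D -> adj (adj M *m D *m M) = adj M *m D *m M.
Proof. by move=> hD; rewrite !adjM adjK hD mulmxA. Qed.

Let hQ : adj Q = Q. Proof. by rewrite QE adj_udu. Qed.

Let rest_herm Z : adj (Q - rest Z) = Q - rest Z.
Proof. by rewrite adjB hQ adjD !sandwich_herm ?fc_herm. Qed.

Let qb := 1 + \sum_i q i.

Let qb0 : 0 < qb.
Proof. by rewrite ltr_wpDr // sumr_ge0 // => i _; apply: ltW. Qed.

Let Q_le v : qf Q v <= qb * fro2 v.
Proof.
rewrite QE; apply: le_udu => // i; rewrite /qb (bigD1 i) //= addrCA lerDl.
by rewrite addr_ge0 // sumr_ge0 // => j _; apply: ltW.
Qed.

(** The added 1 gives a strictly positive constant even for [l] = 0, as [fro2_sandwichD_le]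
    demands. *)
Let bound_of (M : 'M[R[i]]_n) (l : R) : 0 <= l -> (forall v, fro2 (M *m v) <= l * qf Q v) ->
  forall v, fro2 (M *m v) <= (l * qb + 1) * fro2 v.
Proof.
move=> l0 hM v; apply: le_trans (hM v) _; apply: le_trans (ler_wpM2l l0 (Q_le v)) _.
by rewrite mulrA ler_wpM2r ?fro2_ge0 // lerDl.
Qed.

Let fc_ge0 r Z v : 0 <= qf (fc (clip_pow c r) Z) v.
Proof.
rewrite -(mul0r (fro2 v)); apply: ge_udu; first exact: unimx_spectral.
by move=> i; apply: clip_pow_ge0.
Qed.

Let qf_rest Z v : qf (rest Z) v =
  qf (fc (clip_pow c (- t)) (hpart Z)) (A *m v) + qf (fc (clip_pow c (- p)) (hpart Z)) (B *m v).
Proof. by rewrite qfD !qf_conj. Qed.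

Let step_bound Z :
  fro2 (step Z) <= clip_pow (c `^ s) (1 / s) qb ^+ 2 * fro2 (1%:M : 'M[R[i]]_n).
Proof.
have [U [w [UU WE]]] := herm_spectral (rest_herm Z).
rewrite /step WE (fc_udu _ _ UU); apply: fro2_udu_le => // i /=.
rewrite ger0_norm ?clip_pow_ge0 // /clip_pow.
have wq : w i <= qb.
  apply: (udu_le UU) => v; rewrite -WE qfB qf_rest; apply: le_trans (Q_le v).
  by rewrite lerBlDr lerDl addr_ge0.
have m0 x : 0 <= Num.max x (c `^ s) by rewrite le_max (ltW cs0) orbT.
apply: (ge0_ler_powR (ltW s'0)); rewrite ?nnegrE //.
by rewrite ge_max !le_max wq lexx orbT.
Qed.

Let step_lip : exists2 K, 0 <= K & forall Z Z', fro2 (step Z - step Z') <= K * fro2 (Z - Z').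
Proof.
pose L := 1 / s * c `^ (1 - s).
pose S := lip_inv t * (al * qb + 1) + lip_inv p * (be * qb + 1).
have a0 : 0 < al * qb + 1 by rewrite ltr_wpDl // mulr_ge0 // ltW.
have b0 : 0 < be * qb + 1 by rewrite ltr_wpDl // mulr_ge0 // ltW.
exists (L ^+ 2 * S ^+ 2) => [|Z Z']; first by rewrite mulr_ge0 ?sqr_ge0.
have fcl r : 0 < r -> fro2 (fc (clip_pow c (- r)) (hpart Z) - fc (clip_pow c (- r)) (hpart Z'))
    <= lip_inv r ^+ 2 * fro2 (Z - Z').
  move=> r0; apply: (@le_trans _ _ (lip_inv r ^+ 2 * fro2 (hpart Z - hpart Z'))).
    apply: fc_lip; rewrite ?hpart_herm // => x y.
    have := @clip_pow_lip c (- r) x y; rewrite normrN (gtr0_norm r0); apply=> //.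
    by rewrite (le_trans _ ler01) // oppr_le0 ltW.
  by rewrite ler_wpM2l ?sqr_ge0 ?hpart_lip.
have := fro2_sandwichD_le a0 (bound_of al0 hA) b0 (bound_of be0 hB)
  (lip_inv_gt0 t0) (lip_inv_gt0 p0) (fcl t t0) (fcl p p0); rewrite -/S.
rewrite (@eqn_sub A B Q (Q - rest Z) (Q - rest Z')); [|exact: subrK..].
have -> : - (Q - rest Z - (Q - rest Z')) = (-1)%:C *: (Q - rest Z - (Q - rest Z')).
  by rewrite rmorphN rmorph1 scaleN1r.
rewrite fro2Z sqrrN expr1n mul1r => h.
apply: (@le_trans _ _ (L ^+ 2 * fro2 (Q - rest Z - (Q - rest Z')))).
  apply: fc_lip; rewrite ?rest_herm // => x y.
  have := clip_pow_lip x y s'1 cs0.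
  by rewrite root_slope (ger0_norm (ltW s'0)).
by rewrite -[leRHS]mulrA ler_wpM2l ?sqr_ge0.
Qed.

Lemma eqn_solution_exists : exists U d,
  [/\ unimx U, forall i, c <= d i, eqn_solution U d &
      ple (udu U d) (upow V q (1 / s))].
Proof.
have [K K0 stepK] := step_lip.
have [|X stepX] := mx_bounded_lipschitz_fixpoint _ K0 step_bound stepK.
  by rewrite mulr_ge0 ?sqr_ge0 ?fro2_ge0.
have [U [w [UU WE]]] := herm_spectral (rest_herm X).
pose d i := clip_pow (c `^ s) (1 / s) (w i).
have XE : X = udu U d by rewrite -stepX /step WE (fc_udu _ _ UU).
(* A fixed point is a value of the clipped root, so its eigenvalues are at least [c] before any
   estimate; this switches off the inner clips and makes the estimate [cw] possible. *)
have cd i : c <= d i.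
  have -> : c = (c `^ s) `^ (1 / s).
    by rewrite -powRrM mulrC divfK ?gt_eqF // powRr1 // ltW.
  have m0 : c `^ s <= Num.max (w i) (c `^ s) by rewrite le_max lexx orbT.
  by apply: (ge0_ler_powR (ltW s'0)); rewrite // nnegrE ?(le_trans _ m0) // ltW.
have d0 i : 0 < d i by exact: lt_le_trans (cd i).
have fcE r : fc (clip_pow c r) (hpart X) = upow U d r.
  rewrite hpart_id; last by rewrite XE adj_udu.
  rewrite XE (fc_udu _ _ UU); apply: eq_udu => i /=.
  by rewrite /clip_pow; congr (_ `^ _); apply/max_idPl.
have upow_le r v : 0 < r -> qf (upow U d (- r)) v <= c `^ (- r) * fro2 v.
  move=> r0; apply: le_udu => // i; have h : c `^ r <= d i `^ r.
    by apply: (ge0_ler_powR (ltW r0)); [exact: ltW | exact: ltW (d0 i) | exact: cd].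
  rewrite !powRN; have dr0 := powR_gt0 r (d0 i); have cr0 := powR_gt0 r c0.
  by rewrite lef_pV2.
have restE : rest X = adj A *m upow U d (- t) *m A + adj B *m upow U d (- p) *m B.
  by rewrite /rest !fcE.
have cw i : c `^ s <= w i.
  apply: (udu_ge UU) => v; rewrite -WE qfB; apply: le_trans (hc v) _.
  rewrite restE qfD !qf_conj.
  have h1 : qf (upow U d (- t)) (A *m v) <= al * c `^ (- t) * qf Q v.
    apply: le_trans (upow_le _ _ t0) _; rewrite [al * _]mulrC -mulrA.
    by rewrite ler_wpM2l ?powR_ge0.
  have h2 : qf (upow U d (- p)) (B *m v) <= be * c `^ (- p) * qf Q v.
    apply: le_trans (upow_le _ _ p0) _; rewrite [be * _]mulrC -mulrA.
    by rewrite ler_wpM2l ?powR_ge0.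
  rewrite !mulrBl mul1r -addrA -opprD lerD2l lerN2.
  exact: lerD h1 h2.
have w0 i : 0 < w i by exact: lt_le_trans (cw i).
have dw i : d i = w i `^ (1 / s).
  by rewrite /d /clip_pow; congr (_ `^ _); apply/max_idPl.
exists U, d; split; [exact: UU | exact: cd | rewrite /eqn_solution |].
  have -> : upow U d s = Q - rest X.
    rewrite WE; apply: eq_udu => i.
    by rewrite dw -powRrM (divfK (lt0r_neq0 s0)) (powRr1 (ltW (w0 i))).
  by rewrite -restE subrK.
have -> : udu U d = upow U w (1 / s) by apply: eq_udu.
apply: (loewner_heinz UU VV w0 q0); last by rewrite s'1 ltW.
rewrite -WE -QE => v; rewrite qfB qf_rest lerBlDr lerDl.
by rewrite addr_ge0.
Qed.

End Existence.

End Equation.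
End MatrixEquation.

From mathcomp Require Import Rstruct Rstruct_topology.

(** * From A Q^-1 A^* <= a I to A^* A <= a Q *)

Section InverseBound.
Local Open Scope ring_scope.
Local Open Scope complex_scope.
Variables (R : rcfType) (n : nat).
Implicit Types (A Q : 'M[R[i]]_n) (v w : 'cV[R[i]]_n).

(* Expand [0 <= <u - a v, Q (u - a v)>] for [u = Q^-1 A^* A v]. *)
Lemma fro2_le_of_conj_inv A Q Qi (a : R) : adj Q = Q -> Q *m Qi = 1%:M ->
  (forall v, 0 <= qf Q v) -> 0 < a ->
  (forall w, qf (A *m Qi *m adj A) w <= a * fro2 w) ->
  forall v, fro2 (A *m v) <= a * qf Q v.
Proof.
move=> hQ QQi Q0 a0 h v; set w := A *m v; pose u := Qi *m (adj A *m w).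
have Qu : Q *m u = adj A *m w by rewrite /u mulmxA QQi mul1mx.
have sw x y : sesq x Q y = sesq y Q x by rewrite sesqC hQ.
have svu : sesq v Q u = fro2 w.
  by rewrite -qf1 /qf -[Q]mul1mx sesq_mulr Qu !sesq1 mulmxA -adjM -/w.
have suu : sesq u Q u <= a * fro2 w.
  apply: le_trans (h w); rewrite -[Q]mul1mx sesq_mulr Qu sesqC.
  rewrite le_eqVlt; apply/orP; left; apply/eqP.
  have -> : adj (1%:M : 'M[R[i]]_n) = 1%:M by rewrite /adj trmx1 map_mx1.
  rewrite sesq1 /qf /sesq /u adjM adjK !mulmxA; congr (complex.Re _).
have := Q0 (u + (- a)%:C *: v).
rewrite /qf !(sesqDl, sesqDr, sesqZl, sesqZr) (sw u v) svu -/(qf Q v) => h2.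
rewrite -(ler_pM2l a0).
move: h2 suu; move: (sesq u Q u) (fro2 w) (qf Q v) => x y z; clear -a0.
nra.
Qed.

End InverseBound.

(** * Functions on indices as complex matrices *)

Section Bridge.
Local Open Scope ring_scope.
Local Open Scope complex_scope.

Definition toC (z : Defs.C) : R[i] := Complex (Defs.Re z) (Defs.Im z).
Definition ofC (z : R[i]) : Defs.C := mkC (complex.Re z) (complex.Im z).

Lemma ofCK z : toC (ofC z) = z. Proof. by case: z. Qed.
Lemma toC_inj : injective toC. Proof. by move=> [a b] [c d] [-> ->]. Qed.

Lemma toC_add x y : toC (Cadd x y) = toC x + toC y. Proof. by []. Qed.
Lemma toC_mul x y : toC (Cmul x y) = toC x * toC y. Proof. by []. Qed.
Lemma toC_conj x : toC (Cconj x) = conjc (toC x). Proof. by []. Qed.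

Lemma toC_sum n f : toC (Csum n f) = \sum_(i < n) toC (f i).
Proof.
suff h k : toC (List.fold_right Cadd C0 (List.map f (List.seq k n))) =
    \sum_(i < n) toC (f (k + i)%N).
  by rewrite /Csum h; apply: eq_bigr => i _; rewrite add0n.
elim: n k => [|n IH] k; first by rewrite big_ord0.
rewrite big_ord_recl /= toC_add IH addn0; congr (_ + _).
by apply: eq_bigr => i _; rewrite /bump /= addnCA addnA.
Qed.

Section Dimension.
Variable n : nat.

Definition toM (A : Mat) : 'M[R[i]]_n := \matrix_(i, j) toC (A i j).
Definition toV (v : Vec) : 'cV[R[i]]_n := \col_i toC (v i).
(** Matrices of the statement are functions on all of [nat]; outside the range they are padded with
    a default that [meq] never inspects. *)
Definition extend T (x : T) (f : 'I_n -> T) (i : nat) : T :=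
  if insub i is Some k then f k else x.
Definition ofM (M : 'M[R[i]]_n) : Mat :=
  fun i j => extend C0 (fun k => extend C0 (fun l => ofC (M k l)) j) i.
Definition ofV (v : 'cV[R[i]]_n) : Vec := extend C0 (fun k => ofC (v k 0)).

Lemma extendE T (x : T) f (i : 'I_n) : extend x f i = f i.
Proof. by rewrite /extend valK. Qed.

Lemma ofMK M : toM (ofM M) = M.
Proof. by apply/matrixP => i j; rewrite mxE /ofM !extendE ofCK. Qed.

Lemma ofVK v : toV (ofV v) = v.
Proof. by apply/colP => i; rewrite mxE /ofV extendE ofCK. Qed.

Lemma meqE A B : meq n A B <-> toM A = toM B.
Proof.
split=> [h|/matrixP h i j /ssrnat.ltP ni /ssrnat.ltP nj].
  by apply/matrixP => i j; rewrite !mxE (h i j) //; apply/ssrnat.ltP.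
by apply: toC_inj; have := h (Ordinal ni) (Ordinal nj); rewrite !mxE.
Qed.

Lemma toM_add A B : toM (madd A B) = toM A + toM B.
Proof. by apply/matrixP => i j; rewrite !mxE. Qed.

Lemma toM_sub A B : toM (msub A B) = toM A - toM B.
Proof. by apply/matrixP => i j; rewrite !mxE. Qed.

Lemma toM_scale (r : R) A : toM (mscale r A) = r%:C *: toM A.
Proof. by apply/matrixP => i j; rewrite !mxE. Qed.

Lemma toM_mul A B : toM (mmul n A B) = toM A *m toM B.
Proof.
apply/matrixP => i j; rewrite !mxE toC_sum; apply: eq_bigr => k _.
by rewrite !mxE toC_mul.
Qed.

Lemma toM_adj A : toM (madj A) = adj (toM A).
Proof. by apply/matrixP => i j; rewrite !mxE. Qed.

Lemma toM_id : toM mid = 1%:M.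
Proof.
apply/matrixP => i j; rewrite !mxE /mid -val_eqE /=.
case: eqP => [->|/eqP/negbTE h]; rewrite ?Nat.eqb_refl //.
by rewrite (introF (Nat.eqb_spec _ _)) //; apply/eqP; rewrite h.
Qed.

Lemma toM_diag (d : nat -> R) : toM (mdiag d) = rdiag (fun i : 'I_n => d i).
Proof.
apply/matrixP => i j; rewrite !mxE /mdiag -val_eqE /=.
case: (Nat.eqb_spec i j) => [->|/eqP/negbTE ->]; first by rewrite eqxx mulr1n.
by rewrite mulr0n.
Qed.

Lemma toV_mvec A v : toV (mvec n A v) = toM A *m toV v.
Proof.
by apply/colP => i; rewrite !mxE toC_sum; apply: eq_bigr => k _; rewrite !mxE toC_mul.
Qed.

Lemma toC_inner u v : toC (inner n u v) = (adj (toV u) *m toV v) 0 0.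
Proof.
by rewrite toC_sum mxE; apply: eq_bigr => k _; rewrite !mxE toC_mul toC_conj.
Qed.

Lemma Re_inner_mvec A v : Defs.Re (inner n v (mvec n A v)) = qf (toM A) (toV v).
Proof.
by rewrite -[LHS]/(complex.Re (toC _)) toC_inner toV_mvec /qf /sesq mulmxA.
Qed.

Lemma Re_inner v : Defs.Re (inner n v v) = fro2 (toV v).
Proof. by rewrite -[LHS]/(complex.Re (toC _)) toC_inner -qf1 /qf sesq1. Qed.

Lemma hermitianE A : Defs.hermitian n A <-> adj (toM A) = toM A.
Proof. by rewrite /Defs.hermitian meqE toM_adj. Qed.

Lemma vnonzeroE v : vnonzero n v <-> toV v != 0.
Proof.
split=> [[i [/ssrnat.ltP ni vi]]|v0].
  apply/eqP => /colP/(_ (Ordinal ni)); rewrite !mxE /= => E.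
  by apply: vi; apply: toC_inj; rewrite E.
have /existsP[i vi] : [exists i, toV v i 0 != 0].
  rewrite -negb_forall; apply: contra v0 => /forallP h.
  by apply/eqP/colP => i; rewrite [RHS]mxE; apply/eqP.
exists i; split; first by apply/ssrnat.ltP.
by move=> E; move: vi; rewrite mxE E; apply/negP; rewrite negbK.
Qed.

Lemma mleE P Q : mle n P Q <->
  [/\ adj (toM P) = toM P, adj (toM Q) = toM Q & ple (toM P) (toM Q)].
Proof.
rewrite /mle /psd !hermitianE; split=> [[hP [hQ [_ h]]]|[hP hQ h]].
  split=> // v; have := h (ofV v); rewrite Re_inner_mvec ofVK toM_sub qfB => /RleP.
  by rewrite R0E subr_ge0.
split=> //; split=> //; split; first by rewrite toM_sub adjB hP hQ.
by move=> v; rewrite Re_inner_mvec toM_sub qfB; apply/RleP; rewrite R0E subr_ge0.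
Qed.

Lemma pdE P : pd n P <->
  adj (toM P) = toM P /\ forall v, v != 0 -> 0 < qf (toM P) v.
Proof.
rewrite /pd hermitianE; split=> -[hP h]; split=> // v v0.
  have := h (ofV v); rewrite vnonzeroE Re_inner_mvec ofVK => /(_ v0) /RltP.
  by rewrite R0E.
by rewrite Re_inner_mvec; apply/RltP; rewrite R0E; apply/h/vnonzeroE.
Qed.

Lemma unitaryE U : unitary n U <-> unimx (toM U).
Proof. by rewrite /unitary meqE toM_mul toM_adj toM_id. Qed.

Lemma RpowerE (x y : R) : 0 < x -> Rpower x y = x `^ y.
Proof. by move=> x0; rewrite /Rpower /powR gt_eqF // RexpE RlnE. Qed.

Lemma herm_pos_spectral (M : 'M[R[i]]_n) : adj M = M ->
  (forall v, v != 0 -> 0 < qf M v) ->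
  exists V q, [/\ unimx V, forall i, 0 < q i & M = udu V q].
Proof.
move=> hM M0; have [V [q [VV ME]]] := herm_spectral hM; exists V, q; split=> // i.
rewrite -(qf_udu_col q i VV) -ME; apply: M0; apply/eqP => c0.
have := fro2_col_uni i VV; rewrite c0 -qf1 /qf /sesq mulmx0 mxE => /eqP.
by rewrite eq_sym oner_eq0.
Qed.

Lemma invertibleE A : invertible n A -> exists B, B *m toM A = 1%:M.
Proof. by move=> [B [_ /meqE]]; rewrite toM_mul toM_id; exists (toM B). Qed.

(** The power -1 shows that an inverse exists, so [epsilon] returns one; uniqueness of inverses
    identifies it with that power, which is Hermitian. *)
Lemma toM_minv Q V q : unimx V -> (forall i, 0 < q i) -> toM Q = udu V q ->
  toM Q *m toM (minv n Q) = 1%:M /\ adj (toM (minv n Q)) = toM (minv n Q).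
Proof.
move=> VV q0 QE.
have P1 : udu V q *m upow V q (-1) = 1%:M.
  by rewrite -(upow1 V q0) (upowD _ _ VV q0) subrr (upow0 _ VV).
have P2 := mulmx1C P1.
have [h1 _] : meq n (mmul n Q (minv n Q)) mid /\ meq n (mmul n (minv n Q) Q) mid.
  apply: (@epsilon_spec _ (inhabits mid) (fun B => meq n (mmul n Q B) mid /\
    meq n (mmul n B Q) mid)); exists (ofM (upow V q (-1))).
  by split; apply/meqE; rewrite toM_mul ofMK toM_id QE; [exact: P1 | exact: P2].
move/meqE: h1; rewrite toM_mul toM_id => h1; split=> //.
suff -> : toM (minv n Q) = upow V q (-1) by exact: upow_herm.
by rewrite -[LHS]mul1mx -P2 -mulmxA -QE h1 mulmx1.
Qed.

(** [epsilon] may return the power computed in any eigenbasis; by [udu_fun_eq] they all agree with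
    the one in the basis [V]. *)
Lemma toM_mpow Q V q (r : R) : unimx V -> (forall i, 0 < q i) -> toM Q = udu V q ->
  toM (mpow n Q r) = upow V q r.
Proof.
move=> VV q0 QE.
have [U [d [/unitaryE UU [d0 [/meqE hQ /meqE hY]]]]] : is_rpow n Q r (mpow n Q r).
  apply: (@epsilon_spec _ (inhabits mid) (fun Y => is_rpow n Q r Y)).
  exists (ofM (upow V q r)); exists (ofM V), (extend 1 q).
  split; first by apply/unitaryE; rewrite ofMK.
  split=> [i /ssrnat.ltP ni|].
    by apply/RltP; rewrite R0E (extendE 1 q (Ordinal ni)).
  by split; apply/meqE; rewrite !toM_mul toM_adj !ofMK toM_diag mulmxA ?QE;
    apply: eq_udu => i; rewrite extendE // RpowerE.
move: hQ hY; rewrite !toM_mul !toM_adj !toM_diag !mulmxA QE => hQ ->.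
have d0' (i : 'I_n) : 0 < d i by apply/RltP/d0; apply/ssrnat.ltP.
have -> : toM U *m rdiag (fun i : 'I_n => Rpower (d i) r) *m adj (toM U) =
    udu (toM U) ((fun x => x `^ r) \o (fun i : 'I_n => d i)).
  by apply: eq_udu => i; rewrite /= RpowerE.
exact/esym/(udu_fun_eq _ VV UU).
Qed.

Lemma is_eigenvalueE M (l : R) : is_eigenvalue n M l <->
  exists2 v : 'cV_n, v != 0 & toM M *m v = l%:C *: v.
Proof.
split=> [[v [/vnonzeroE v0 h]]|[v v0 h]].
  exists (toV v) => //; rewrite -toV_mvec; apply/colP => i; rewrite !mxE h //.
  exact/ssrnat.ltP.
exists (ofV v); split; first by apply/vnonzeroE; rewrite ofVK.
move=> i /ssrnat.ltP ni; apply: toC_inj.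
have := congr1 (fun w : 'cV_n => w (Ordinal ni) 0) h.
by rewrite -{1 2}[v]ofVK -toV_mvec !mxE.
Qed.

(** * Largest eigenvalue, spectral norm and assembly in positive dimension *)

Hypothesis n0 : (0 < n)%N.

(** The largest entry of [d], which exists as n > 0, meets the specification of [lambda1]: an
    eigenvalue m with eigenvector v satisfies m |v|^2 = <v, M v>. *)
Lemma lambda1P M : adj (toM M) = toM M ->
  forall v, qf (toM M) v <= lambda1 n M * fro2 v.
Proof.
move=> hM; have [U [d [UU ME]]] := herm_spectral hM.
have eig i : is_eigenvalue n M (d i).
  apply/is_eigenvalueE; exists (col i U); last by rewrite ME (udu_col _ _ UU).
  apply/eqP => c0; have := fro2_col_uni i UU.
  by rewrite c0 -qf1 /qf /sesq mulmx0 mxE => /eqP; rewrite eq_sym oner_eq0.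
have [i _ imax] := @Order.TotalTheory.arg_maxP _ R _ (Ordinal n0) predT d isT.
have [_ lmax] : is_eigenvalue n M (lambda1 n M) /\
    (forall m, is_eigenvalue n M m -> (m <= lambda1 n M)%R).
  have [|h1 h2] := @epsilon_spec _ (inhabits 0%R)
    (fun l => is_eigenvalue n M l /\ forall m, is_eigenvalue n M m -> Rle m l).
    exists (d i); split=> // m /is_eigenvalueE[v v0 hv]; apply/RleP.
    have f0 := fro2_vec_gt0 v0; rewrite -(ler_pM2r f0).
    have -> : m * fro2 v = qf (toM M) v.
      by rewrite -[toM M]mul1mx /qf sesq_mulr hv sesqZr -/(qf _ _) qf1.
    by rewrite ME; apply: le_udu => // j; apply: imax.
  by split=> // m hm; apply/RleP/h2.
by rewrite {1}ME; apply: le_udu => // j; apply: lmax.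
Qed.

Lemma vnormE v : vnorm n v = Num.sqrt (fro2 (toV v)).
Proof. by rewrite /vnorm Re_inner RsqrtE. Qed.

Lemma fro2_mul_bounded (M : 'M[R[i]]_n) :
  exists2 K : R, 0 <= K & forall v : 'cV_n, fro2 (M *m v) <= K * fro2 v.
Proof.
have hM : adj (adj M *m M) = adj M *m M by rewrite adjM adjK.
have [U [d [UU ME]]] := herm_spectral hM.
exists (\sum_i `|d i|) => [|v]; first by rewrite sumr_ge0.
rewrite -qf1 -qf_conj mulmx1 ME; apply: le_udu => // i.
by rewrite (bigD1 i) //= (le_trans (ler_norm _)) // lerDl sumr_ge0.
Qed.

(** The set is bounded and, as n > 0, nonempty, so [epsilon] returns its supremum. The left inverse
    excludes the value 0; the contraction estimate asks for strictly positive constants. *)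
Lemma specnormP A (Ai : 'M[R[i]]_n) : Ai *m toM A = 1%:M ->
  0 < specnorm n A ^+ 2 /\ forall v : 'cV_n, fro2 (toM A *m v) <= specnorm n A ^+ 2 * fro2 v.
Proof.
move=> AiA; pose E r := exists v : Vec, vnorm n v = 1%R /\ r = vnorm n (mvec n A v).
have [e e1] : exists e : 'cV[R[i]]_n, fro2 e = 1.
  exists (col (Ordinal n0) 1%:M); apply: fro2_col_uni.
  by rewrite /unimx mulmx1 /adj trmx1 map_mx1.
have [ub _] : is_lub E (specnorm n A).
  apply: (@epsilon_spec _ (inhabits (IZR 0)) (fun m => is_lub E m)).
  have [K K0 hK] := fro2_mul_bounded (toM A).
  have [||m hm] := completeness E; last by exists m.
    exists (Num.sqrt K) => _ [v [v1 ->]]; apply/RleP.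
    move: v1; rewrite !vnormE toV_mvec => v1; rewrite ler_sqrt //.
    apply: le_trans (hK _) _.
    by rewrite -[leRHS]mulr1 -[1](expr1n _ 2) -v1 sqr_sqrtr ?fro2_ge0.
  exists (vnorm n (mvec n A (ofV e))), (ofV e); split=> //.
  by rewrite vnormE ofVK e1 sqrtr1.
have hv (v : 'cV_n) : fro2 (toM A *m v) <= specnorm n A ^+ 2 * fro2 v.
  have [->|v0] := eqVneq v 0.
    by rewrite mulmx0 -qf1 /qf /sesq mulmx0 mxE mulr0.
  have f0 := fro2_vec_gt0 v0; have s0 : 0 < Num.sqrt (fro2 v) by rewrite sqrtr_gt0.
  pose u := ((Num.sqrt (fro2 v))^-1)%:C *: v.
  have u1 : fro2 u = 1.
    by rewrite fro2Z exprVn sqr_sqrtr ?fro2_ge0 // mulVf ?gt_eqF.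
  have : E (Num.sqrt (fro2 (toM A *m u))).
    exists (ofV u); rewrite !vnormE toV_mvec ofVK u1 sqrtr1; split=> //.
  move/ub => /RleP h.
  have sn0 : 0 <= specnorm n A := le_trans (sqrtr_ge0 _) h.
  have {h} : Num.sqrt (fro2 (toM A *m u)) ^+ 2 <= specnorm n A ^+ 2.
    by rewrite lerXn2r ?nnegrE ?sqrtr_ge0.
  rewrite sqr_sqrtr ?fro2_ge0 // /u -scalemxAr fro2Z exprVn sqr_sqrtr ?fro2_ge0 //.
  by rewrite mulrC ler_pdivrMr.
split=> //; rewrite lt_def sqr_ge0 andbT; apply/eqP => z.
have := hv e; rewrite z mul0r => /fro2_eq0 Ae.
have : e = 0 by rewrite -[e]mul1mx -AiA -mulmxA Ae mulmx0.
move=> e0; move: e1; rewrite e0 -qf1 /qf /sesq mulmx0 mxE => /eqP.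
by rewrite eq_sym oner_eq0.
Qed.

(** Isolates what the maximum [c1] provides: it is positive and its powers bound the two largest
    eigenvalues. *)
Lemma equation_theorem (s t p c1 k : R) A B Q :
  1 <= s -> 1 <= t -> 1 <= p -> invertible n A -> invertible n B -> pd n Q ->
  0 < c1 -> 0 < k ->
  lambda1 n (mmul n A (mmul n (minv n Q) (madj A))) <= c1 `^ t ->
  lambda1 n (mmul n B (mmul n (minv n Q) (madj B))) <= c1 `^ p ->
  k `^ (- t) + k `^ (- p) < 1 ->
  lambda1 n (mscale (c1 `^ s) (minv n Q)) <= (1 - k `^ (- t) - k `^ (- p)) * k `^ (- s) ->
  mle n (mscale (k * c1) mid) (mpow n Q (1 / s)) /\
  exists X : Mat,
    pd n X /\ in_interval n (mscale (k * c1) mid) (mpow n Q (1 / s)) X /\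
    is_solution n s t p A B Q X /\
    (1 / s * (k * c1) `^ (1 - s) *
       (t / (k * c1) `^ (t + 1) * specnorm n A ^+ 2 +
        p / (k * c1) `^ (p + 1) * specnorm n B ^+ 2) < 1 ->
     forall Y : Mat,
       in_interval n (mscale (k * c1) mid) (mpow n Q (1 / s)) Y ->
       is_solution n s t p A B Q Y -> meq n Y X).
Proof.
move=> s1 t1 p1 /invertibleE[Ai AiA] /invertibleE[Bi BiB] /pdE[hQ Qpos] c10 k0 lA lB kk lQ.
have [V [q [VV q0 QE]]] := herm_pos_spectral hQ Qpos.
have [QQi hQi] := toM_minv VV q0 QE.
have c0 : 0 < k * c1 by rewrite mulr_gt0.
have Q0 v : 0 <= qf (toM Q) v.
  by rewrite -(mul0r (fro2 v)) QE; apply: ge_udu => // i; apply: ltW.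
have bound M r : lambda1 n (mmul n M (mmul n (minv n Q) (madj M))) <= c1 `^ r ->
    forall v, fro2 (toM M *m v) <= c1 `^ r * qf (toM Q) v.
  move=> lM; apply: (fro2_le_of_conj_inv hQ QQi Q0 (powR_gt0 r c10)) => w.
  have hM : adj (toM M *m toM (minv n Q) *m adj (toM M)) =
            toM M *m toM (minv n Q) *m adj (toM M).
    by rewrite !adjM adjK hQi mulmxA.
  have ME : toM (mmul n M (mmul n (minv n Q) (madj M))) =
            toM M *m toM (minv n Q) *m adj (toM M).
    by rewrite !toM_mul toM_adj mulmxA.
  have := @lambda1P (mmul n M (mmul n (minv n Q) (madj M))); rewrite ME => /(_ hM w).
  by move/le_trans; apply; rewrite ler_wpM2r ?fro2_ge0.
pose ka := 1 - k `^ (- t) - k `^ (- p).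
have ka0 : 0 < ka by rewrite /ka -addrA -opprD subr_gt0.
have cs0 : 0 < c1 `^ s := powR_gt0 s c10.
have ks0 : 0 < k `^ s := powR_gt0 s k0.
(* The inverse bound with the identity in place of A: Q^-1 <= b I gives I <= b Q, where b = [ka] /
   (k^s c1^s) is read off from [lQ]. *)
have hc v : (k * c1) `^ s * fro2 v <= ka * qf (toM Q) v.
  have b0 : 0 < ka / (k `^ s * c1 `^ s) by rewrite divr_gt0 // mulr_gt0.
  have h w : qf (1%:M *m toM (minv n Q) *m adj 1%:M) w <= ka / (k `^ s * c1 `^ s) * fro2 w.
    have -> : adj (1%:M : 'M[R[i]]_n) = 1%:M by rewrite /adj trmx1 map_mx1.
    rewrite mul1mx mulmx1.
    have := @lambda1P (mscale (c1 `^ s) (minv n Q)).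
    rewrite toM_scale adjZ hQi => /(_ erefl w); rewrite qfZ => h.
    have {h} := le_trans h (ler_wpM2r (fro2_ge0 w) lQ).
    rewrite -/ka powRN -ler_pdivlMl // => /le_trans; apply.
    by rewrite le_eqVlt; apply/orP; left; apply/eqP; field; rewrite !gt_eqF.
  have := fro2_le_of_conj_inv hQ QQi Q0 b0 h v; rewrite mul1mx => h3.
  rewrite (powRM _ (ltW k0) (ltW c10)) -(ler_pdivlMl _ _ (mulr_gt0 ks0 cs0)).
  by rewrite mulrCA mulrA.
(* Here [c1] cancels, which is how k^(-t) and k^(-p) enter the condition on [k]. *)
have shrink r : c1 `^ r * (k * c1) `^ (- r) = k `^ (- r).
  rewrite powRM ?ltW // !powRN mulrCA divff ?mulr1 // gt_eqF // powR_gt0 //.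
have hc' v : (k * c1) `^ s * fro2 v <=
    (1 - c1 `^ t * (k * c1) `^ (- t) - c1 `^ p * (k * c1) `^ (- p)) * qf (toM Q) v.
  by rewrite !shrink; apply: hc.
have [U [d [UU cd sol leQ]]] := eqn_solution_exists s1 t1 p1 c0 VV q0 QE
  (powR_ge0 _ _) (powR_ge0 _ _) (bound A t lA) (bound B p lB) hc'.
have d0 i : 0 < d i by exact: lt_le_trans (cd i).
have QsE := toM_mpow (1 / s) VV q0 QE.
have cE : toM (mscale (k * c1) mid) = (k * c1)%:C%:M by rewrite toM_scale toM_id scalemx1.
have hcI : adj ((k * c1)%:C%:M : 'M[R[i]]_n) = (k * c1)%:C%:M.
  by rewrite -(udu_const _ UU) adj_udu.
have geX : ple ((k * c1)%:C%:M) (udu U d) by move=> v; rewrite qf_scalar; apply: ge_udu.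
have solE X W e : unimx W -> (forall i, 0 < e i) -> toM X = udu W e ->
    is_solution n s t p A B Q X <-> eqn_solution (toM A) (toM B) (toM Q) s t p W e.
  move=> WW e0 XE; rewrite /is_solution meqE !toM_add !toM_mul !toM_adj.
  rewrite 3!(toM_mpow _ WW e0 XE).
  rewrite (mulmxA (adj (toM A))) (mulmxA (adj (toM B))).
  exact: iff_refl.
split.
  (* The inequality k c1 I <= Q^(1/s) is read off from the solution, which lies between the two
     sides. *)
  apply/mleE; rewrite QsE cE; split; [exact: hcI | exact: upow_herm |].
  by move=> v; apply: le_trans (geX v) (leQ v).
exists (ofM (udu U d)); split.
  apply/pdE; rewrite ofMK; split=> [|v v0]; first exact: adj_udu.
  apply: lt_le_trans (geX v); rewrite qf_scalar; apply: mulr_gt0 c0 _.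
  exact: fro2_vec_gt0.
split.
  split; first by apply/hermitianE; rewrite ofMK adj_udu.
  split; apply/mleE; rewrite ofMK ?QsE ?cE; split.
  - exact: hcI.
  - exact: adj_udu.
  - exact: geX.
  - exact: adj_udu.
  - exact: upow_herm.
  - exact: leQ.
split; first by apply/(solE _ _ _ UU d0 (ofMK _)).
move=> lt1 Y [/hermitianE hY [/mleE[_ _]]]; rewrite cE => leY _ solY.
have [U' [d' [UU' YE]]] := herm_spectral hY.
have cd' : forall i, k * c1 <= d' i.
  by apply: (udu_ge UU') => v; rewrite -qf_scalar -YE.
have d0' i : 0 < d' i by exact: lt_le_trans (cd' i).
move/(solE _ _ _ UU' d0' YE): solY => solY.
have [a0 hA] := specnormP AiA; have [b0 hB] := specnormP BiB.
apply/meqE; rewrite ofMK YE.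
apply: (eqn_solution_unique s1 t1 p1 c0 UU' UU cd' cd solY sol a0 hA b0 hB).
have lipE r : lip_inv (k * c1) r = r / (k * c1) `^ (r + 1).
  by rewrite /lip_inv -powRN opprD.
by rewrite !lipE.
Qed.

End Dimension.
End Bridge.

Open Scope R_scope.
Theorem mainTheorem10 (n : nat) (s t p : R) (A B Q : Mat) (k : R) :
  1 <= s -> 1 <= t -> 1 <= p ->
  invertible n A -> invertible n B -> pd n Q ->
  let c1 := Rmax (Rpower (lambda1 n (mmul n A (mmul n (minv n Q) (madj A)))) (1 / t))
                 (Rpower (lambda1 n (mmul n B (mmul n (minv n Q) (madj B)))) (1 / p)) in
  0 < k ->
  Rpower k (- t) + Rpower k (- p) < 1 ->
  lambda1 n (mscale (Rpower c1 s) (minv n Q))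
    <= (1 - Rpower k (- t) - Rpower k (- p)) * Rpower k (- s) ->
  mle n (mscale (k * c1) mid) (mpow n Q (1 / s)) /\
  exists X : Mat,
    pd n X /\ in_interval n (mscale (k * c1) mid) (mpow n Q (1 / s)) X /\
    is_solution n s t p A B Q X /\
    (1 / s * Rpower (k * c1) (1 - s) *
       (t / Rpower (k * c1) (t + 1) * (specnorm n A) ^ 2 +
        p / Rpower (k * c1) (p + 1) * (specnorm n B) ^ 2) < 1 ->
     forall Y : Mat,
       in_interval n (mscale (k * c1) mid) (mpow n Q (1 / s)) Y ->
       is_solution n s t p A B Q Y -> meq n Y X).
Proof.
move=> s1 t1 p1 iA iB pQ c1 k0; have [n0|n0] := posnP n.
  (* In dimension 0 there is no eigenvalue and [lambda1] is unspecified, but all matrices are equal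
     and the claims become trivial. *)
  subst n; move=> _ _.
  have mx0 (X Y : 'M[R[i]%C]_0) : X = Y by rewrite [LHS]flatmx0 [RHS]flatmx0.
  have mle0 P P' : mle 0 P P'.
    apply/mleE; split; [exact: mx0 | exact: mx0 | move=> v].
    by rewrite (mx0 (toM 0 P) (toM 0 P')).
  split; first exact: mle0.
  exists Q; split; first exact: pQ.
  split; first by split; [apply/hermitianE; exact: mx0 | split; exact: mle0].
  by split=> [|_ Y _ _]; apply/meqE; exact: mx0.
have Rpower_gt0 x y : (0 < Rpower x y)%R by apply/RltP; exact: exp_pos.
have c10 : (0 < c1)%R by rewrite /c1 RmaxE lt_max Rpower_gt0.
move/RltP: k0 => k0; rewrite R0E in k0.
(* For l <= 0 the value of [Rpower l] carries no information, but the bound by a nonnegative power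
   is then immediate. *)
have le_powR l x r : Rle 1 r -> (0 < x)%R -> (Rpower l (1 / r) <= x)%R -> (l <= x `^ r)%R.
  move=> /RleP r1 x0; have r0 : (0 < r)%R by apply: lt_le_trans r1; rewrite R1E ltr01.
  have [l0 _|l0] := leP l 0%R; first by rewrite (le_trans l0) // powR_ge0.
  rewrite RpowerE // => h.
  have -> : l = ((l `^ (1 / r)) `^ r)%R.
    by rewrite -powRrM divfK ?gt_eqF // powRr1 // ltW.
  by apply: (ge0_ler_powR (ltW r0)); rewrite ?nnegrE ?powR_ge0 // ltW.
have lA : (lambda1 n (mmul n A (mmul n (minv n Q) (madj A))) <= c1 `^ t)%R.
  by apply: le_powR => //; rewrite /c1 RmaxE le_max lexx.
have lB : (lambda1 n (mmul n B (mmul n (minv n Q) (madj B))) <= c1 `^ p)%R.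
  by apply: le_powR => //; rewrite /c1 RmaxE le_max lexx orbT.
have kc0 : (0 < k * c1)%R by rewrite mulr_gt0.
rewrite !(RpowerE _ k0) !(RpowerE _ c10) !(RpowerE _ kc0) => /RltP kk /RleP lQ.
move/RleP: s1 => s1; move/RleP: t1 => t1; move/RleP: p1 => p1.
have [h1 [X [h2 [h3 [h4 h5]]]]] :=
  equation_theorem n0 s1 t1 p1 iA iB pQ c10 k0 lA lB kk lQ.
split; first exact: h1.
exists X; split; [exact: h2 | split; [exact: h3 | split; [exact: h4 |]]].
move=> /RltP; rewrite !RpowE => lt1; exact: h5 lt1.
Qed.
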